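(* Let $U\in\mathcal G_k\mathcal P_n$ be a polynomial subspace and let $Q=W(U)$ be its Wronskian covariant, regarded as an element of $\mathcal P_N$, $N=k\ell=k(n+1-k)$, defined up to a nonzero scalar multiple. The following are equivalent: (1) $U$ is projectively equivalent to a monomial subspace; (2) $Q=W(U)$ has either one or two distinct roots; (3) $H[Q]=0$ or $J^2[Q]$ is constant; (4) $\mathrm{Stab}(Q)$ is infinite, of one of the following two types: a 2-dimensional subgroup consisting of fractional linear transformations that fix exactly one point in $\hat{\mathbb C}$, or a 1-dimensional subgroup consisting of fractional linear transformations that fix exactly two points in $\hat{\mathbb C}$.
   Context: Work over $\mathbb C$, with $\hat{\mathbb C}=\mathbb C\cup\{\infty\}$. Here $n\ge0$, $1\le k\le n+1$ and $\ell=n+1-k$. $\mathcal P_m$ is the vector space of polynomials in $z$ of degree $\le m$; $\mathcal G_k\mathcal P_n$ is the Grassmannian of $k$-dimensional subspaces of $\mathcal P_n$. For a fractional linear transformation $g$, $z=\frac{a\hat z+b}{c\hat z+d}$ with $ad-bc=1$, and $p\in\mathcal P_m$, set $(g\cdot p)(\hat z)=(c\hat z+d)^m\,p\!\left(\frac{a\hat z+b}{c\hat z+d}\right)$, and $g\cdot V=\{g\cdot p:p\in V\}$ for subspaces $V\subset\mathcal P_m$; this depends only on the class of $g$ in $\mathrm{PSL}_2\mathbb C$. Subspaces $U,\hat U\in\mathcal G_k\mathcal P_n$ are projectively equivalent if $\hat U=g\cdot U$ for some $g$. A monomial subspace is one of the form $\mathrm{span}\{z^{\nu_1},\dots,z^{\nu_k}\}$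 with $0\le\nu_1<\cdots<\nu_k\le n$. $W(U)$ is the line spanned by the Wronskian $\det(p_i^{(j-1)})_{1\le i,j\le k}\in\mathcal P_N$ of any basis $p_1,\dots,p_k$ of $U$. Roots of $Q\in\mathcal P_N$ are taken in $\hat{\mathbb C}$, where $\infty$ is a root of multiplicity $N-\deg Q$. $\mathrm{Stab}(Q)$ is the group of $g\in\mathrm{PSL}_2\mathbb C$ with $g\cdot\mathrm{span}\{Q\}=\mathrm{span}\{Q\}$ under the action on subspaces of $\mathcal P_N$. The covariants of $Q\in\mathcal P_N$ are $$H[Q]=N(N-1)\left[QQ''-\frac{N-1}{N}(Q')^2\right],$$ $$T[Q]=-N^2(N-1)\left[Q^2Q'''-3\frac{N-2}{N}QQ'Q''+2\frac{(N-1)(N-2)}{N^2}(Q')^3\right],$$ and $J^2[Q]=T[Q]^2/H[Q]^3$ (a rational function, considered when $H[Q]\neq0$).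
   Formalization: The case k=n+1 (N=0) is excluded, as Q is then constant with no roots and (2) fails; in (4), ''fix exactly one/two points'' means common fixed points of the group, and elements may swap the two points, as z -> -1/z does for Q=z in P_2. *)

(* Defs.v *)
From HB Require Import structures.
From mathcomp Require Import all_boot all_order all_algebra.
From mathcomp Require Import all_classical all_reals all_analysis.
From mathcomp Require Import complex ring.

Set Implicit Arguments.
Unset Strict Implicit.
Unset Printing Implicit Defensive.

Import Order.TTheory GRing.Theory Num.Theory.
Import numFieldNormedType.Exports.

Local Open Scope classical_set_scope.
Local Open Scope ring_scope.
Local Open Scope complex_scope.

(* P_m, the polynomials of degree <= m, is {poly_m.+1 C}. *)

Section Algebra.
Context {C : fieldType}.

(* (c x + d)^m p((a x + b) / (c x + d)) for g = [[a, b], [c, d]], cleared of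
   denominators; see horner_flt_poly. *)
Definition flt_poly (m : nat) (g : 'M[C]_2) (p : {poly C}) : {poly C} :=
  \sum_(i < m.+1) p`_i *: ((g 0 0 *: 'X + (g 0 1)%:P) ^+ i
                           * (g 1 0 *: 'X + (g 1 1)%:P) ^+ (m - i)).

Lemma size_flt_poly m g p : flt_poly m g p \is a poly_of_size m.+1.
Proof.
have sz1 (a b : C) : (size (a *: 'X + b%:P)%R <= 2)%N.
  rewrite (leq_trans (size_polyD _ _)) // geq_max.
  rewrite (leq_trans (size_scale_leq _ _)) ?size_polyX //=.
  by rewrite (leq_trans (size_polyC_leq1 _)).
have szX (q : {poly C}) i : (size q <= 2 -> size (q ^+ i)%R <= i.+1)%N.
  move=> hq; apply: leq_trans (size_poly_exp_leq _ _) _.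
  rewrite ltnS -[leqRHS]mul1n leq_mul2r; apply/orP; right.
  by case: (size q) hq => [|[|[]]].
rewrite qualifE /=; apply: (leq_trans (size_sum _ _ _)).
apply/bigmax_leqP => i _; apply: (leq_trans (size_scale_leq _ _)).
apply: (leq_trans (size_polyMleq _ _)).
have h1 := szX _ i (sz1 (g 0 0) (g 0 1)).
have h2 := szX _ (m - i)%N (sz1 (g 1 0) (g 1 1)).
rewrite -subn1 leq_subLR (leq_trans (leq_add h1 h2)) //.
by rewrite addSn addnS subnKC ?add1n // -ltnS.
Qed.

Lemma horner_flt_poly m (g : 'M[C]_2) (p : {poly_m.+1 C}) x :
  g 1 0 * x + g 1 1 != 0 ->
  (flt_poly m g p).[x] =
    (g 1 0 * x + g 1 1) ^+ m
    * p.[(g 0 0 * x + g 0 1) / (g 1 0 * x + g 1 1)].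
Proof.
move=> nz; have szp : (size (p : {poly C}) <= m.+1)%N by case: p.
rewrite (horner_coef_wide _ szp) mulr_sumr horner_sum; apply: eq_bigr => i _.
have im : (i <= m)%N by rewrite -ltnS.
rewrite !hornerE expr_div_n; set u := _ + _; set v := _ + _ in nz *.
have -> : v ^+ m = v ^+ (m - i) * v ^+ i by rewrite -exprD subnK.
have vi : v ^+ i != 0 by rewrite expf_neq0.
rewrite /=; move: (v ^+ (m - i)) (v ^+ i) (u ^+ i) vi => A B D B0.
by field.
Qed.

Definition flt_act (m : nat) (g : 'M[C]_2) (p : {poly_m.+1 C}) :
  {poly_m.+1 C} := NPoly (size_flt_poly m g p).

Definition SL2 : set 'M[C]_2 := [set g | \det g = 1].

Definition proj_equiv (n : nat) (U V : {vspace {poly_n.+1 C}}) : Prop :=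
  exists2 g, SL2 g & [set` V] = flt_act g @` [set` U].

Definition monomial_subspace (n k : nat) (U : {vspace {poly_n.+1 C}}) : Prop :=
  exists nu : seq nat,
    [/\ size nu = k, sorted ltn nu, all (fun i => i <= n)%N nu
      & U = <<[seq npolyp n.+1 'X^i | i <- nu]>>%VS].

Definition wronskian (k : nat) (p : 'I_k -> {poly C}) : {poly C} :=
  \det (\matrix_(i < k, j < k) (p i)^`(j)).

(* The line W(U) in P_N, N = k (n + 1 - k). *)
Definition wronskian_line (n k : nat) (U : {vspace {poly_n.+1 C}}) :
    set {poly_(k * (n.+1 - k)).+1 C} :=
  [set Q | exists2 e : k.-tuple {poly_n.+1 C}, basis_of U e &
     exists c : C, Q = c *: wronskian (fun i => tnth e i) :> {poly C}].

(* The Riemann sphere; None is the point at infinity. *)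
Definition sphere : Type := option C.

Definition roots_in_sphere (m : nat) (Q : {poly_m.+1 C}) : set sphere :=
  [set x | match x with
           | Some z => root Q z
           | None => (0 < m - (size Q).-1)%N
           end].

Definition mobius (g : 'M[C]_2) (x : sphere) : sphere :=
  match x with
  | Some z => if g 1 0 * z + g 1 1 == 0 then None
              else Some ((g 0 0 * z + g 0 1) / (g 1 0 * z + g 1 1))
  | None => if g 1 0 == 0 then None else Some (g 0 0 / g 1 0)
  end.

(* PSL_2 is realised as the group of fractional linear transformations of the
   sphere, so its subgroups are sets of maps sphere -> sphere. *)
Definition stab (m : nat) (Q : {poly_m.+1 C}) : set (sphere -> sphere) :=
  mobius @` [set g | SL2 g /\ flt_act g @` [set` <[Q]>%VS] = [set` <[Q]>%VS]].

(* G fixes a set F of m points, possibly permuting them, and no further point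
   is fixed by all the elements of G that fix F pointwise.  For m = 1 this says
   that G has exactly one common fixed point.  For m = 2 interchanges must be
   allowed: the stabilizer of z^r in P_(2r) contains z |-> -1/z. *)
Definition fixes_exactly (m : nat) (G : set (sphere -> sphere)) : Prop :=
  exists F : set sphere,
    [/\ (F #= `I_m)%card,
        forall g, G g -> g @` F = F
      & [set x | forall g, G g -> (forall y, F y -> g y = y) -> g x = x] = F].

Definition cov_H (m : nat) (Q : {poly C}) : {poly C} :=
  (m%:R * (m%:R - 1)) *:
    (Q * Q^`(2) - ((m%:R - 1) / m%:R) *: Q^`() ^+ 2).

Definition cov_T (m : nat) (Q : {poly C}) : {poly C} :=
  - (m%:R ^+ 2 * (m%:R - 1)) *:
    (Q ^+ 2 * Q^`(3) - (3 * ((m%:R - 2) / m%:R)) *: (Q * Q^`() * Q^`(2))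
     + (2 * ((m%:R - 1) * (m%:R - 2) / m%:R ^+ 2)) *: Q^`() ^+ 3).

Definition cov_J2 (m : nat) (Q : {poly C}) : {fraction {poly C}} :=
  tofrac (cov_T m Q) ^+ 2 / tofrac (cov_H m Q) ^+ 3.

End Algebra.

Arguments sphere : clear implicits.

Section Dimension.
Context {R : realType}.
Local Notation C := R[i].

Definition expmx (X : 'M[C]_2) : 'M[C]_2 :=
  limn (series (fun i : nat => (i`!%:R)^-1 *: X ^+ i)).

(* The Lie algebra of a closed subgroup G of PSL_2(C), inside sl_2(C). *)
Definition lie_algebra (G : set (sphere C -> sphere C)) : set 'M[C]_2 :=
  [set X | \tr X = 0 /\ forall t : R, G (mobius (expmx (t%:C *: X)))].

(* Complex dimension of a closed complex subgroup. *)
Definition has_group_dim (G : set (sphere C -> sphere C)) (d : nat) : Prop :=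
  exists2 L : {vspace 'M[C]_2}, [set` L] = lie_algebra G & \dim L = d.

End Dimension.

(* Main.v *)
Require Import Defs.
From HB Require Import structures.
From mathcomp Require Import all_boot all_order all_algebra.
From mathcomp Require Import all_classical all_reals all_analysis.
From mathcomp Require Import complex ring zify.

Set Implicit Arguments.
Unset Strict Implicit.
Unset Printing Implicit Defensive.

Import Order.TTheory GRing.Theory Num.Theory.
Import numFieldNormedType.Exports.
Local Open Scope classical_set_scope.
Local Open Scope ring_scope.

(** Why the theorem holds.

    The Wronskian of [U] is compared with a normal form.  Up to a fractional
    linear transformation, a form [Q] of degree [N] with one root on the sphere
    is a constant (its root sits at infinity), and one with two roots is a
    multiple of [X^r] with [0 < r < N]; conversely [X^r] has no roots besides 0
    and infinity ([card_rootsP]).  So (2) says that some transform of [Q] is a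
    monomial.

    For (1) this is matched with subspaces in two steps.  The Wronskian is a
    covariant, [W(g . U) = g . W(U)] ([wronskian_flt]): the [j]-th derivative of
    the transform of [p], times the [j]-th power of the denominator, is a
    unitriangular combination of transforms of derivatives of [p].  And a space
    whose Wronskian is a monomial is spanned by monomials ([monomial_basis]): it
    has a basis whose members have distinct degrees and distinct orders at 0;
    the Wronskian of such a basis has degree and order equal, up to the same
    shift, to the sum of the degrees and the sum of the orders, the extreme
    coefficients being Vandermonde determinants.  For a monomial Wronskian both
    sums agree, hence each member of the basis has its degree equal to its order.

    For (3), if [Q] has one or two roots then [Q' / Q = s / w] with simple [s]
    and [w], and [H] and [T] turn out to be constant multiples of [(Q / w)^2] and
    [(Q / w)^3], so that [H] vanishes or [T^2 / H^3] is constant.  Conversely [T] is, up to sign, the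
    transvectant [N Q H' - (2 N - 4) Q' H].  At a root of [Q] of multiplicity
    [p < N], [H] vanishes to order exactly [2 p - 2]; at any other zero of [H]
    the orders of [T^2] and [H^3] would differ.  This determines the degree of
    [H] from the number of roots, and the leading terms at infinity then allow
    at most two of them ([few_roots_of_cov]).

    For (4), the stabilizer permutes the roots of [Q].  Three roots make it
    finite, since a fractional linear transformation is determined by three
    values.  For the normal forms, the exponential of a traceless matrix [X] is
    a combination of 1 and [X], so that the Lie algebra of the stabilizer
    consists of the traceless triangular matrices for one root and of the
    traceless diagonal ones for two ([stab_of_few_roots]).  The convergence of
    the complex exponential series is deduced from the real exponential, sine
    and cosine. *)

(** * Leading coefficients of products *)

Section LeadingCoefficients.
Context {C : fieldType}.

(** Degrees need not be exact: only bounds on them are known for the entries of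
    a Wronskian matrix, some of which may vanish. *)
Lemma coef_prod_top (I : Type) (r : seq I) (d : I -> nat) (q : I -> {poly C}) :
    (forall i, size (q i) <= (d i).+1)%N ->
  (size (\prod_(i <- r) q i)%R <= (\sum_(i <- r) d i).+1)%N
  /\ (\prod_(i <- r) q i)`_(\sum_(i <- r) d i) = \prod_(i <- r) (q i)`_(d i).
Proof.
move=> hq; elim: r => [|i r [IHs IHc]].
  by rewrite !big_nil size_poly1 coef1.
rewrite !big_cons; split.
  apply: leq_trans (size_polyMleq _ _) _.
  by rewrite -subn1 leq_subLR (leq_trans (leq_add (hq i) IHs)) // addSn addnS add1n.
rewrite coefM (bigD1 (inord (d i))) //= inordK ?ltnS ?leq_addr //.
rewrite addKn IHc [X in _ + X]big1 ?addr0 // => j; rewrite -val_eqE /= inordK ?ltnS ?leq_addr //.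
rewrite neq_ltn => /orP[jd|jd]; last by rewrite nth_default ?mul0r ?(leq_trans (hq i)).
rewrite [X in _ * X]nth_default ?mulr0 // (leq_trans IHs) //.
by rewrite ltn_subRL ltn_add2r.
Qed.

End LeadingCoefficients.

(** * Binary forms and linear substitutions *)

Section BinaryForms.
Context {C : fieldType}.
Implicit Types (p q : {poly C}) (v w : 'cV[C]_2) (g h : 'M[C]_2).

(** The homogenization of degree [m] of [p]: it treats the point at infinity,
    represented by [v = (1, 0)], on a par with the finite ones. *)
Definition form_eval (m : nat) p v : C :=
  \sum_(i < m.+1) p`_i * (v 0 0 ^+ i * v 1 0 ^+ (m - i)).

Lemma form_evalZ m p t v : form_eval m p (t *: v) = t ^+ m * form_eval m p v.
Proof.
rewrite /form_eval mulr_sumr; apply: eq_bigr => i _; rewrite !mxE !exprMn.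
have -> : t ^+ m = t ^+ i * t ^+ (m - i) by rewrite -exprD subnKC // -ltnS.
by ring.
Qed.

Lemma form_eval_scalep m c p v : form_eval m (c *: p) v = c * form_eval m p v.
Proof.
by rewrite /form_eval mulr_sumr; apply: eq_bigr => i _; rewrite coefZ mulrA.
Qed.

Lemma form_eval_sum m (I : Type) (r : seq I) (q : I -> {poly C}) v :
  form_eval m (\sum_(i <- r) q i) v = \sum_(i <- r) form_eval m (q i) v.
Proof.
rewrite /form_eval exchange_big; apply: eq_bigr => i _.
by rewrite coef_sum mulr_suml.
Qed.

Lemma form_eval_horner m p v : (size p <= m.+1)%N -> v 1 0 != 0 ->
  form_eval m p v = v 1 0 ^+ m * p.[v 0 0 / v 1 0].
Proof.
move=> sp v1; rewrite (horner_coef_wide _ sp) mulr_sumr; apply: eq_bigr => i _.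
have -> : v 1 0 ^+ m = v 1 0 ^+ i * v 1 0 ^+ (m - i).
  by rewrite -exprD subnKC // -ltnS.
rewrite expr_div_n; have := expf_neq0 i v1.
move: (v 1 0 ^+ i) (v 1 0 ^+ (m - i)) (v 0 0 ^+ i) => A B D A0.
by field.
Qed.

Lemma form_eval_infty m p v : v 1 0 = 0 -> form_eval m p v = p`_m * v 0 0 ^+ m.
Proof.
move=> v1; rewrite /form_eval big_ord_recr /= subnn expr0 mulr1 big1 ?add0r //.
move=> i _; rewrite v1 expr0n subn_eq0 leqNgt ltn_ord /=.
by rewrite mulr0 mulr0.
Qed.

Lemma size_lin (a b : C) : (size (a *: 'X + b%:P)%R <= 2)%N.
Proof.
rewrite (leq_trans (size_polyD _ _)) // geq_max.
rewrite (leq_trans (size_scale_leq _ _)) ?size_polyX //=.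
by rewrite (leq_trans (size_polyC_leq1 _)).
Qed.

Lemma form_eval_lin_prod (a b c d : C) i j v :
  form_eval (i + j) ((a *: 'X + b%:P) ^+ i * (c *: 'X + d%:P) ^+ j) v
  = (a * v 0 0 + b * v 1 0) ^+ i * (c * v 0 0 + d * v 1 0) ^+ j.
Proof.
set L1 := _ + b%:P; set L2 := _ + d%:P.
pose q (k : 'I_(i + j)) := if fintype.split k is inl _ then L1 else L2.
have hq k : (size (q k) <= 2)%N by rewrite /q; case: fintype.split => _; exact: size_lin.
have prodq (R : comNzRingType) (A B : R) :
    \prod_(k < i + j) (if fintype.split k is inl _ then A else B) = A ^+ i * B ^+ j.
  rewrite big_split_ord /=; congr (_ * _).
    rewrite (eq_bigr (fun=> A)) ?prodr_const ?card_ord // => k _.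
    by rewrite (unsplitK (inl k)).
  rewrite (eq_bigr (fun=> B)) ?prodr_const ?card_ord // => k _.
  by rewrite (unsplitK (inr k)).
have [sz top] := coef_prod_top (index_enum 'I_(i + j)) (d := fun=> 1%N) hq.
rewrite sum_nat_const card_ord muln1 in sz top.
have eq_q : \prod_k q k = L1 ^+ i * L2 ^+ j.
  by rewrite -prodq; apply: eq_bigr => k _; rewrite /q.
have [v1|v1] := eqVneq (v 1 0) 0; last first.
  rewrite form_eval_horner // -?eq_q // eq_q exprD hornerM !horner_exp.
  rewrite mulrACA -!exprMn.
  by congr (_ ^+ _ * _ ^+ _); rewrite !hornerE /=; field.
rewrite form_eval_infty // -eq_q top v1 !mulr0 !addr0 !exprMn.
rewrite mulrACA -exprD -prodq; congr (_ * _); apply: eq_bigr => k _; rewrite /q.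
by case: fintype.split => _; rewrite coefD coefZ coefX coefC /= mulr1 addr0.
Qed.

(** The substitution [g] turns the form of [p] into its pull-back along the
    linear map [g]; at infinity this is where leading coefficients enter. *)
Lemma form_eval_flt m g p v :
  form_eval m (flt_poly m g p) v = form_eval m p (g *m v).
Proof.
rewrite /flt_poly form_eval_sum; apply: eq_bigr => i _.
rewrite form_eval_scalep; congr (_ * _).
have im : (i + (m - i) = m)%N by rewrite subnKC // -ltnS.
rewrite -[X in form_eval X]im form_eval_lin_prod !mxE !big_ord_recl !big_ord0 !addr0.
by rewrite (_ : lift 0 0 = 1) //; apply: val_inj.
Qed.

End BinaryForms.

(** * The Riemann sphere in homogeneous coordinates *)

Section Sphere.
Context {C : numFieldType}.
Implicit Types (p q : {poly C}) (v w : 'cV[C]_2) (g h : 'M[C]_2) (x : sphere C).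

Definition vec_of (x : sphere C) : 'cV[C]_2 :=
  if x is Some z then \col_i (if i == 0 then z else 1)
  else \col_i (if i == 0 then 1 else 0).

Definition pt_of (v : 'cV[C]_2) : sphere C :=
  if v 1 0 == 0 then None else Some (v 0 0 / v 1 0).

Lemma mulmx2E g v i : (g *m v) i 0 = g i 0 * v 0 0 + g i 1 * v 1 0.
Proof.
rewrite !mxE !big_ord_recl !big_ord0 !addr0.
by rewrite (_ : lift 0 0 = 1) //; apply: val_inj.
Qed.

Lemma mulmx22E g h i j : (g *m h) i j = g i 0 * h 0 j + g i 1 * h 1 j.
Proof.
rewrite !mxE !big_ord_recl !big_ord0 !addr0.
by rewrite (_ : lift 0 0 = 1) //; apply: val_inj.
Qed.

Lemma det2 (g : 'M[C]_2) : \det g = g 0 0 * g 1 1 - g 0 1 * g 1 0.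
Proof.
rewrite (expand_det_row _ 0) !big_ord_recl big_ord0 addr0 /cofactor !det_mx11 !mxE.
rewrite (_ : lift 0 0 = 1 :> 'I_2); last exact: val_inj.
rewrite (_ : lift 1 0 = 0 :> 'I_2); last exact: val_inj.
by rewrite /= expr0 expr1 mul1r mulN1r mulrN.
Qed.

Lemma vec2P v w : v 0 0 = w 0 0 -> v 1 0 = w 1 0 -> v = w.
Proof.
move=> h0 h1; apply/matrixP => i j; rewrite (ord1 j).
by case: (unliftP 0 i) => [k ->|->] //; rewrite (ord1 k) (_ : lift 0 0 = 1) //;
   apply: val_inj.
Qed.

Lemma mx2P g h : g 0 0 = h 0 0 -> g 0 1 = h 0 1 -> g 1 0 = h 1 0 ->
  g 1 1 = h 1 1 -> g = h.
Proof.
move=> h00 h01 h10 h11; apply/matrixP => i j.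
have ord2 (k : 'I_2) : k = 0 \/ k = 1.
  by case: k => [[|[|k]] hk]; [left|right|]; try apply: val_inj.
by case: (ord2 i) => ->; case: (ord2 j) => ->.
Qed.

Lemma mobiusE g x : mobius g x = pt_of (g *m vec_of x).
Proof.
by rewrite /pt_of !mulmx2E /mobius; case: x => [z|] /=; rewrite !mxE /= ?mulr1 ?mulr0 ?addr0.
Qed.

Lemma vec_of_neq0 x : vec_of x != 0.
Proof.
apply/eqP; case: x => [z|] /matrixP h.
  by move: (h 1 0); rewrite !mxE /=; move/eqP; rewrite oner_eq0.
by move: (h 0 0); rewrite !mxE /=; move/eqP; rewrite oner_eq0.
Qed.

Lemma pt_ofK v : v != 0 -> exists2 t : C, t != 0 & vec_of (pt_of v) = t *: v.
Proof.
rewrite /pt_of; have [v1 v0|v1 _] := eqVneq (v 1 0) 0; last first.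
  exists (v 1 0)^-1; first by rewrite invr_eq0.
  by apply: vec2P; rewrite !mxE /= ?mulVf // mulrC.
have v00 : v 0 0 != 0.
  by apply: contraNneq v0 => v0; apply/eqP/vec2P; rewrite mxE.
exists (v 0 0)^-1; first by rewrite invr_eq0.
by apply: vec2P; rewrite !mxE /= ?mulVf // v1 mulr0.
Qed.

Lemma vec_ofK x : pt_of (vec_of x) = x.
Proof. by case: x => [z|]; rewrite /pt_of !mxE /= ?eqxx // oner_eq0 divr1. Qed.

Lemma pt_ofZ t v : t != 0 -> pt_of (t *: v) = pt_of v.
Proof.
move=> t0; rewrite /pt_of !mxE mulf_eq0 (negbTE t0) /=.
by case: eqVneq => // v1; rewrite -mulf_div divff // mul1r.
Qed.

Lemma mulmx_vec_neq0 g v : g \in unitmx -> v != 0 -> g *m v != 0.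
Proof.
move=> gu; apply: contraNneq => gv0.
by rewrite -(mulKmx gu v) gv0 mulmx0.
Qed.

Lemma vec_of_mobius g x : g \in unitmx ->
  exists2 t : C, t != 0 & vec_of (mobius g x) = t *: (g *m vec_of x).
Proof.
by move=> gu; rewrite mobiusE; apply/pt_ofK/mulmx_vec_neq0 => //; exact: vec_of_neq0.
Qed.

Lemma mobiusM g h x : h \in unitmx ->
  mobius (g *m h) x = mobius g (mobius h x).
Proof.
move=> hu; rewrite mobiusE [RHS]mobiusE; have [t t0 ->] := vec_of_mobius x hu.
by rewrite -scalemxAr pt_ofZ // mulmxA.
Qed.

Lemma mobius1 x : mobius (1%:M : 'M[C]_2) x = x.
Proof. by rewrite mobiusE mul1mx vec_ofK. Qed.

Lemma mobiusK g : g \in unitmx -> cancel (mobius g) (mobius (invmx g)).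
Proof. by move=> gu x; rewrite -mobiusM // mulVmx // mobius1. Qed.

Lemma mobiusVK g : g \in unitmx -> cancel (mobius (invmx g)) (mobius g).
Proof. by move=> gu x; rewrite -mobiusM ?unitmx_inv // mulmxV // mobius1. Qed.

Lemma SL2_unit g : SL2 g -> g \in unitmx.
Proof. by rewrite unitmxE => ->; rewrite unitr1. Qed.

Lemma SL2_mul g h : SL2 g -> SL2 h -> SL2 (g *m h).
Proof. by rewrite /SL2 /= det_mulmx => -> ->; rewrite mulr1. Qed.

Lemma SL2_inv g : SL2 g -> SL2 (invmx g).
Proof. by rewrite /SL2 /= det_inv => ->; rewrite invr1. Qed.

Lemma poly_horner_inj p q : (forall z, p.[z] = q.[z]) -> p = q.
Proof.
move=> pq; apply/eqP; rewrite -subr_eq0; apply/negPn/negP => d0.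
pose rs := [seq (i%:R : C) | i <- iota 0 (size (p - q))].
have /(max_poly_roots d0) : all (root (p - q)) rs.
  by apply/allP => z _; rewrite rootE !hornerE pq subrr.
rewrite map_inj_uniq ?iota_uniq => [/(_ isT)|i j /eqP]; last by rewrite eqr_nat => /eqP.
by rewrite size_map size_iota ltnn.
Qed.

Lemma form_eval_inj m p q : (size p <= m.+1)%N -> (size q <= m.+1)%N ->
  (forall v, form_eval m p v = form_eval m q v) -> p = q.
Proof.
move=> sp sq pq; apply: poly_horner_inj => z.
have := pq (vec_of (Some z)).
by rewrite !form_eval_horner ?mxE /= ?oner_eq0 // !divr1 expr1n !mul1r.
Qed.

Lemma flt_poly1 m p : (size p <= m.+1)%N -> flt_poly m 1%:M p = p.
Proof.
move=> sp; apply: (@form_eval_inj m) => // [|v].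
  exact: (size_flt_poly m 1%:M p).
by rewrite form_eval_flt mul1mx.
Qed.

(** The substitutions compose contravariantly: they act on the right. *)
Lemma flt_polyM m g h p :
  flt_poly m g (flt_poly m h p) = flt_poly m (h *m g) p.
Proof.
apply: (@form_eval_inj m) => [||v].
- exact: (size_flt_poly m g _).
- exact: (size_flt_poly m _ p).
by rewrite !form_eval_flt mulmxA.
Qed.

Lemma flt_polyZ m g c p : flt_poly m g (c *: p) = c *: flt_poly m g p.
Proof.
by rewrite /flt_poly scaler_sumr; apply: eq_bigr => i _; rewrite coefZ scalerA.
Qed.

Lemma flt_polyD m g p q :
  flt_poly m g (p + q) = flt_poly m g p + flt_poly m g q.
Proof.
by rewrite /flt_poly -big_split; apply: eq_bigr => i _; rewrite coefD scalerDl.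
Qed.

Lemma flt_poly0 m g : flt_poly m g 0 = 0.
Proof. by rewrite /flt_poly big1 // => i _; rewrite coef0 scale0r. Qed.

Lemma flt_polyVK m g p : g \in unitmx -> (size p <= m.+1)%N ->
  flt_poly m (invmx g) (flt_poly m g p) = p.
Proof. by move=> gu sp; rewrite flt_polyM mulmxV // flt_poly1. Qed.

Lemma roots_in_sphereE m (Q : {poly_m.+1 C}) x : Q != 0 ->
  roots_in_sphere Q x <-> form_eval m Q (vec_of x) = 0.
Proof.
move=> Q0; have sQ : (size (Q : {poly C}) <= m.+1)%N by case: (Q).
case: x => [z|]; rewrite /roots_in_sphere /=.
  rewrite form_eval_horner ?mxE /= ?oner_eq0 // !divr1 expr1n mul1r rootE.
  by split=> /eqP.
rewrite form_eval_infty ?mxE //= expr1n mulr1 subn_gt0.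
have Q0' : (Q : {poly C}) != 0 by [].
have sQ0 : (0 < size (Q : {poly C}))%N by rewrite size_poly_gt0.
split=> [hs|Qm]; first by rewrite nth_default // -(prednK sQ0).
rewrite ltn_neqAle -ltnS prednK // sQ andbT; apply/eqP => sm.
by move: Q0'; rewrite -lead_coef_eq0 lead_coefE sm Qm eqxx.
Qed.

Lemma roots_in_sphere_flt m (g : 'M[C]_2) (Q : {poly_m.+1 C}) x :
    g \in unitmx -> Q != 0 ->
  roots_in_sphere (flt_act g Q) x <-> roots_in_sphere Q (mobius g x).
Proof.
move=> gu Q0; have sQ : (size (Q : {poly C}) <= m.+1)%N by case: (Q).
have gQ0 : flt_act g Q != 0.
  apply: contraNneq Q0 => /(congr1 val) /= gQ0; apply/eqP/val_inj => /=.
  by rewrite -[LHS](flt_polyVK gu sQ) gQ0 flt_poly0.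
rewrite !roots_in_sphereE // form_eval_flt.
have [t t0 ->] := vec_of_mobius x gu.
rewrite form_evalZ; split=> [->|/eqP]; first by rewrite mulr0.
by rewrite mulf_eq0 expf_eq0 (negbTE t0) andbF => /eqP.
Qed.

End Sphere.

(** * Wronskians and their extreme coefficients *)

Section WronskianAlgebra.
Context {C : numFieldType}.

Lemma wronskian_mulmx k (A : 'M[C]_k) (p : 'I_k -> {poly C}) :
  wronskian (fun i => \sum_j A i j *: p j) = \det A *: wronskian p.
Proof.
rewrite /wronskian -mul_polyC -det_map_mx -det_mulmx; congr (\det _).
apply/matrixP => i j; rewrite !mxE linear_sum /=; apply: eq_bigr => l _.
by rewrite !mxE derivnZ mul_polyC.
Qed.

(** Multiplying column [j] by [X^j] makes differentiation homogeneous of degree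
    zero, so that degrees and orders at 0 can be read off row by row. *)
Definition euler_wronskian k (p : 'I_k -> {poly C}) : {poly C} :=
  \det (\matrix_(i < k, j < k) ('X^j * (p i)^`(j))).

Lemma euler_wronskianE k (p : 'I_k -> {poly C}) :
  euler_wronskian p = 'X^(\sum_(j < k) j) * wronskian p.
Proof.
rewrite /euler_wronskian /wronskian -[in RHS]det_tr.
rewrite (_ : 'X^_ = \det (diag_mx (\row_(j < k) ('X^j : {poly C})))); last first.
  rewrite det_diag; under [RHS]eq_bigr do rewrite mxE.
  by elim/big_rec2: _ => [|i x y _ <-]; rewrite ?expr0 // exprD.
rewrite -det_mulmx -det_tr; congr (\det _); apply/matrixP => i j.
by rewrite mxE mul_diag_mx !mxE.
Qed.

Lemma coef_Xn_derivn (p : {poly C}) j m :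
  ('X^j * p^`(j))`_m = (m ^_ j)%:R * p`_m.
Proof.
rewrite coefXnM; case: ltnP => mj; first by rewrite ffact_small // mul0r.
by rewrite coef_derivn subnKC // mulr_natl.
Qed.

Lemma coef_prod_low (I : Type) (r : seq I) (d : I -> nat) (q : I -> {poly C}) :
    (forall i m, (m < d i)%N -> (q i)`_m = 0) ->
  (forall m, (m < \sum_(i <- r) d i)%N -> (\prod_(i <- r) q i)`_m = 0)
  /\ (\prod_(i <- r) q i)`_(\sum_(i <- r) d i) = \prod_(i <- r) (q i)`_(d i).
Proof.
move=> hq; elim: r => [|i r [IHl IHc]].
  by rewrite !big_nil; split=> [m|]; rewrite ?ltn0 ?coef1.
rewrite !big_cons; split=> [m hm|].
  rewrite coefM big1 // => j _; have [jd|jd] := ltnP j (d i).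
    by rewrite hq // mul0r.
  rewrite IHl ?mulr0 // ltn_subLR; last by rewrite -ltnS.
  by rewrite (leq_trans hm) // leq_add2r.
rewrite coefM (bigD1 (inord (d i))) //= inordK ?ltnS ?leq_addr //.
rewrite addKn IHc [X in _ + X]big1 ?addr0 // => j.
rewrite -val_eqE /= inordK ?ltnS ?leq_addr // neq_ltn => /orP[jd|jd].
  by rewrite hq ?mul0r.
rewrite IHl ?mulr0 // ltn_subLR; last by rewrite -ltnS.
by rewrite ltn_add2r.
Qed.

Lemma coef_det k (q : 'M[{poly C}]_k) (d : 'I_k -> nat) :
    (forall s : 'I_k -> 'I_k, (\prod_i q i (s i))`_(\sum_i d i)
                                = \prod_i (q i (s i))`_(d i)) ->
  (\det q)`_(\sum_i d i) = \det (\matrix_(i, j) (q i j)`_(d i)).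
Proof.
move=> hq; rewrite /determinant coef_sum; apply: eq_bigr => s _.
rewrite !mulr_sign; under [in RHS]eq_bigr do rewrite mxE.
by case: (perm.odd_perm s); rewrite ?coefN hq.
Qed.

Lemma natr_ffact m j : (m ^_ j)%:R = \prod_(l < j) (m%:R - l%:R) :> C.
Proof.
elim: j => [|j IH]; first by rewrite big_ord0.
rewrite ffactnSr big_ord_recr /= -IH natrM; have [jm|mj] := leqP j m.
  by rewrite natrB.
by rewrite ffact_small // !mul0r.
Qed.

(** The falling factorials are monic polynomials of degrees [0, 1, 2, ...], so
    this determinant is the Vandermonde determinant of the exponents. *)
Lemma det_ffact_neq0 k (d : 'I_k -> nat) : injective d ->
  \det (\matrix_(i < k, j < k) (d i ^_ j)%:R : 'M[C]_k) != 0.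
Proof.
move=> d_inj; pose P (j : nat) : {poly C} := \prod_(l < j) ('X - (l%:R)%:P).
have sP j : size (P j) = j.+1 by rewrite size_prod_XsubC /index_enum -enumT size_enum_ord.
have mP j : (P j)`_j = 1.
  have /monicP : P j \is monic by exact: monic_prod_XsubC.
  by rewrite lead_coefE sP.
pose B : 'M[C]_k := \matrix_(j, l) (P j)`_l.
rewrite -det_tr (_ : _^T = B *m Vandermonde k (\row_i (d i)%:R)); last first.
  apply/matrixP => j i; rewrite !mxE natr_ffact.
  have -> : \prod_(l < j) ((d i)%:R - l%:R) = (P j).[(d i)%:R].
    by rewrite horner_prod; apply: eq_bigr => l _; rewrite !hornerE.
  rewrite (@horner_coef_wide _ k) ?sP //.
  by apply: eq_bigr => l _; rewrite !mxE.
rewrite det_mulmx det_Vandermonde det_trig; last first.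
  by apply/is_trig_mxP => i j ij; rewrite mxE nth_default // sP.
rewrite mulf_neq0 //; first by apply/prodf_neq0 => i _; rewrite mxE mP oner_eq0.
apply/prodf_neq0 => i _; apply/prodf_neq0 => j ij.
rewrite !mxE subr_eq0 eqr_nat; apply: contraTneq ij => /d_inj ->.
by rewrite ltnn.
Qed.

(** The hypothesis covers both ends: [d] lists either the degrees or the orders
    at 0.  In both cases the extreme coefficient is a product of nonzero
    coefficients and the determinant of falling factorials. *)
Lemma coef_euler_wronskian_neq0 k (p : 'I_k -> {poly C}) (d : 'I_k -> nat) :
    injective d -> (forall i, (p i)`_(d i) != 0) ->
    (forall i, size (p i) <= (d i).+1)%N
    \/ (forall i m, (m < d i)%N -> (p i)`_m = 0) ->
  (euler_wronskian p)`_(\sum_i d i) != 0.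
Proof.
move=> d_inj pd hp; rewrite /euler_wronskian coef_det; last first.
  move=> s; case: hp => [hp|hp].
    apply: (proj2 (coef_prod_top _ _)) => i; rewrite mxE.
    by apply/leq_sizeP => m hm; rewrite coef_Xn_derivn nth_default ?mulr0 // (leq_trans (hp i)).
  apply: (proj2 (coef_prod_low _ _)) => i m hm; rewrite mxE.
  by rewrite coef_Xn_derivn hp ?mulr0.
rewrite (_ : \matrix_(i, j) _ =
    diag_mx (\row_i (p i)`_(d i)) *m \matrix_(i < k, j < k) (d i ^_ j)%:R).
  rewrite det_mulmx det_diag mulf_neq0 ?det_ffact_neq0 //.
  by apply/prodf_neq0 => i _; rewrite mxE.
by apply/matrixP => i j; rewrite mul_diag_mx !mxE coef_Xn_derivn mulrC.
Qed.

Lemma Xn_mul_eq_monomial (W : {poly C}) a b c : c != 0 ->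
  'X^a * W = c *: 'X^b -> (a <= b)%N /\ W = c *: 'X^(b - a).
Proof.
move=> c0 h; have ab : (a <= b)%N.
  rewrite leqNgt; apply/negP => ba; have /eqP := congr1 (fun q : {poly C} => q`_b) h.
  by rewrite coefXnM ba coefZ coefXn eqxx mulr1 eq_sym (negbTE c0).
split=> //; have X0 : 'X^a != 0 :> {poly C} by rewrite -size_poly_eq0 size_polyXn.
apply: (mulfI X0); rewrite h -{1}(subnKC ab) exprD.
by rewrite -scalerAr.
Qed.

Lemma wronskian_monomials k (nu : 'I_k -> nat) : injective nu ->
  exists2 c : C, c != 0 & exists r, wronskian (fun i => 'X^(nu i)) = c *: 'X^r.
Proof.
move=> nu_inj; pose D : 'M[C]_k := \matrix_(i, j) (nu i ^_ j)%:R.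
have eW : euler_wronskian (fun i => 'X^(nu i)) = \det D *: 'X^(\sum_i nu i).
  rewrite /euler_wronskian.
  rewrite (_ : \matrix_(i, j) _ =
    diag_mx (\row_i ('X^(nu i) : {poly C})) *m map_mx polyC D).
    rewrite det_mulmx det_diag det_map_mx mulrC mul_polyC; congr (_ *: _).
    under eq_bigr do rewrite mxE.
    by elim/big_rec2: _ => [|i x y _ ->]; rewrite ?expr0 // exprD.
  apply/matrixP => i j; rewrite mul_diag_mx !mxE; apply/polyP => m.
  rewrite coef_Xn_derivn coefMC coefXn.
  by case: eqVneq => [->|_]; rewrite ?mulr0 ?mul0r // mulr1 mul1r.
exists (\det D); first exact: det_ffact_neq0.
exists (\sum_i nu i - \sum_(j < k) j)%N.
apply: (proj2 (Xn_mul_eq_monomial (det_ffact_neq0 nu_inj) _)).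
by rewrite -euler_wronskianE eW.
Qed.

End WronskianAlgebra.

(** * Bases adapted to degrees and orders *)

Section AdaptedBasis.
Context {C : numFieldType}.

Definition order0 (p : {poly C}) : nat := find (predC1 0) p.

Lemma order0_small (p : {poly C}) m : (m < order0 p)%N -> p`_m = 0.
Proof. by move=> /(before_find 0) /negbFE /eqP. Qed.

Lemma order0_lt_size (p : {poly C}) : p != 0 -> (order0 p < size p)%N.
Proof.
move=> p0; rewrite -has_find; apply/hasP; exists (lead_coef p).
  by rewrite mem_nth // prednK // size_poly_gt0.
by rewrite /= lead_coef_eq0.
Qed.

Lemma coef_order0_neq0 (p : {poly C}) : p != 0 -> p`_(order0 p) != 0.
Proof. by move=> /order0_lt_size; rewrite -has_find => /(nth_find 0). Qed.

Lemma order0_ge (p : {poly C}) n : p != 0 ->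
  (forall m, (m < n)%N -> p`_m = 0) -> (n <= order0 p)%N.
Proof.
move=> p0 h; rewrite leqNgt; apply/negP => /h /eqP.
by rewrite (negbTE (coef_order0_neq0 p0)).
Qed.

Lemma unitmx_transvection k (c : C) (i j : 'I_k) : i != j ->
  (1%:M - c *: delta_mx i j : 'M[C]_k) \in unitmx.
Proof.
move=> ij; set E : 'M[C]_k := c *: delta_mx i j.
have EE : E *m E = 0.
  by rewrite -scalemxAl -scalemxAr mul_delta_mx_cond eq_sym (negbTE ij) mulr0n !scaler0.
have /mulmx1_unit[] // : (1%:M - E) *m (1%:M + E) = 1%:M.
by rewrite mulmxDr mulmx1 mulmxBl mul1mx EE subr0 subrK.
Qed.

Definition spread (p : {poly C}) : nat := size p - order0 p.

Lemma wronskian_neq0_row k (p : 'I_k -> {poly C}) i : wronskian p != 0 -> p i != 0.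
Proof.
apply: contraNneq => pi0; rewrite /wronskian (expand_det_row _ i) big1 // => j _.
by rewrite mxE pi0 linear0 mul0r.
Qed.

Lemma combine_mulmx k (A B : 'M[C]_k) (p : 'I_k -> {poly C}) i :
  \sum_j (A *m B) i j *: p j = \sum_j A i j *: (\sum_l B j l *: p l).
Proof.
under [RHS]eq_bigr do rewrite scaler_sumr.
rewrite exchange_big; apply: eq_bigr => l _ /=.
by rewrite mxE scaler_suml; apply: eq_bigr => j _; rewrite scalerA.
Qed.

Lemma combine_transvection k (p : 'I_k -> {poly C}) c i j l :
  \sum_m (1%:M - c *: delta_mx i j : 'M[C]_k) l m *: p m
  = if l == i then p i - c *: p j else p l.
Proof.
have sum1 (D : 'I_k -> C) (a : 'I_k) :
    (forall m, m != a -> D m = 0) -> \sum_m D m *: p m = D a *: p a.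
  move=> h; rewrite (bigD1 a) //= big1 ?addr0 // => m /h ->.
  by rewrite scale0r.
under eq_bigr do rewrite !mxE scalerBl.
rewrite sumrB (sum1 _ l); last by move=> m; rewrite eq_sym => /negbTE ->.
rewrite (sum1 _ j); last by move=> m /negbTE ->; rewrite andbF mulr0.
rewrite !eqxx scale1r andbT; case: eqVneq => [->|_]; first by rewrite mulr1.
by rewrite mulr0 scale0r subr0.
Qed.

(** A basis of least total spread is adapted to both ends: if two members shared
    their degree or their order at 0, subtracting a multiple of one from the
    other would shrink the spread. *)
Lemma adapted_basis k (p : 'I_k -> {poly C}) : wronskian p != 0 ->
  exists2 A : 'M[C]_k, A \in unitmx &
    let q := fun i => \sum_j A i j *: p j in
    injective (fun i => size (q i)) /\ injective (fun i => order0 (q i)).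
Proof.
have [n] := ubnP (\sum_i spread (p i)); elim: n p => // n IH p hn Wp.
have p0 i : p i != 0 := wronskian_neq0_row i Wp.
(* one elimination step that strictly decreases the total spread *)
have step i j (c : C) : i != j ->
    (p i - c *: p j != 0 -> (spread (p i - c *: p j)%R < spread (p i))%N) ->
    exists2 A : 'M[C]_k, A \in unitmx &
      let q := fun i => \sum_j A i j *: p j in
      injective (fun i => size (q i)) /\ injective (fun i => order0 (q i)).
  move=> ij dec; pose E : 'M[C]_k := 1%:M - c *: delta_mx i j.
  have Eu : E \in unitmx by exact: unitmx_transvection.
  pose p' l := \sum_m E l m *: p m.
  have p'E l : p' l = if l == i then p i - c *: p j else p l.
    exact: combine_transvection.
  have Wp' : wronskian p' != 0.
    rewrite wronskian_mulmx scaler_eq0 negb_or Wp andbT.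
    by rewrite -unitfE -unitmxE.
  have [|A Au [szA orA]] := IH p' _ Wp'.
    rewrite -ltnS; apply: leq_trans hn; rewrite ltnS.
    rewrite (bigD1 i) //= [X in (_ < X)%N](bigD1 i) //= -addSn leq_add //.
      rewrite p'E eqxx dec //.
      by have := wronskian_neq0_row i Wp'; rewrite p'E eqxx.
    by apply/eq_leq/eq_bigr => l /negbTE li; rewrite p'E li.
  exists (A *m E); first by rewrite unitmx_mul Au.
  by split=> [i1 i2|i1 i2]; rewrite /= !combine_mulmx; [move/szA|move/orA].
have [/injectiveP sz|/injectivePn[i [j ij sij]]] :=
    boolP (injectiveb (fun i => size (p i))); last first.
  wlog oij : i j ij sij / (order0 (p i) <= order0 (p j))%N.
    move=> W; case: (leqP (order0 (p i)) (order0 (p j))) => [|/ltnW] oij.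
      exact: W ij sij oij.
    by apply: (W j i); rewrite // eq_sym.
  apply: (step i j (lead_coef (p i) / lead_coef (p j))) => // r0.
  set r := _ - _ in r0 *.
  have lj : lead_coef (p j) != 0 by rewrite lead_coef_eq0.
  have si : (0 < size (p i))%N by rewrite size_poly_gt0.
  have sr : (size r < size (p i))%N.
    rewrite -[X in (_ < X)%N](prednK si) ltnS; apply/leq_sizeP => m.
    rewrite leq_eqVlt => /orP[/eqP <-|hm].
      rewrite coefB coefZ {2}sij -/(lead_coef (p j)) divfK //.
      by rewrite lead_coefE subrr.
    have hm' : (size (p i) <= m)%N by rewrite -(prednK si).
    by rewrite coefB coefZ !nth_default ?mulr0 ?subr0 -?sij.
  have or : (order0 (p i) <= order0 r)%N.
    apply: order0_ge => // m hm.
    by rewrite coefB coefZ !order0_small ?mulr0 ?subr0 // (leq_trans hm).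
  rewrite /spread; apply: (@leq_ltn_trans (size r - order0 (p i))).
    by rewrite leq_sub2l.
  by rewrite ltn_sub2r // order0_lt_size.
have [/injectiveP or|/injectivePn[i [j ij oij]]] :=
    boolP (injectiveb (fun i => order0 (p i))); last first.
  wlog sij : i j ij oij / (size (p j) <= size (p i))%N.
    move=> W; case: (leqP (size (p j)) (size (p i))) => [|/ltnW] sij.
      exact: W ij oij sij.
    by apply: (W j i); rewrite // eq_sym.
  apply: (step i j ((p i)`_(order0 (p i)) / (p j)`_(order0 (p j)))) => // r0.
  set r := _ - _ in r0 *.
  have cj := coef_order0_neq0 (p0 j).
  have sr : (size r <= size (p i))%N.
    rewrite (leq_trans (size_polyD _ _)) // geq_max leqnn size_polyN.
    by rewrite (leq_trans (size_scale_leq _ _)).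
  have or : (order0 (p i) < order0 r)%N.
    apply: order0_ge => // m; rewrite ltnS leq_eqVlt => /orP[/eqP ->|hm].
      by rewrite coefB coefZ {3}oij divfK // subrr.
    have pj : (p j)`_m = 0 by apply: order0_small; rewrite -oij.
    by rewrite coefB coefZ pj (order0_small hm) mulr0 subr0.
  rewrite /spread; apply: (@leq_ltn_trans (size (p i) - order0 r)).
    by rewrite leq_sub2r.
  by rewrite ltn_sub2l // order0_lt_size.
exists 1%:M; first exact: unitmx1.
have e i : \sum_j (1%:M : 'M[C]_k) i j *: p j = p i.
  rewrite (bigD1 i) //= big1 ?addr0 ?mxE ?eqxx ?scale1r // => j.
  by rewrite mxE eq_sym => /negbTE ->; rewrite scale0r.
by split=> i j; rewrite /= !e; [exact: sz|exact: or].
Qed.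

(** For an adapted basis the extreme coefficients of the Wronskian sit at the
    sum of the degrees and at the sum of the orders; when the Wronskian is a
    monomial these agree, and every member of the basis is a monomial. *)
Lemma monomial_basis k (p : 'I_k -> {poly C}) (c : C) r :
    c != 0 -> wronskian p = c *: 'X^r ->
  exists2 A : 'M[C]_k, A \in unitmx &
    exists2 nu : 'I_k -> nat, injective nu &
      forall i, \sum_j A i j *: p j = 'X^(nu i).
Proof.
move=> c0 Wp; have Wp0 : wronskian p != 0.
  by rewrite Wp scaler_eq0 negb_or c0 -size_poly_eq0 size_polyXn.
have [A Au] := adapted_basis Wp0.
set q := fun i => _ => -[sz_inj or_inj].
have Wq : wronskian q = (\det A * c) *: 'X^r by rewrite wronskian_mulmx Wp scalerA.
have dA : \det A != 0 by rewrite -unitfE -unitmxE.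
have q0 i : q i != 0.
  apply: wronskian_neq0_row; rewrite Wq scaler_eq0 negb_or mulf_neq0 //=.
  by rewrite -size_poly_eq0 size_polyXn.
have sgt i : (0 < size (q i))%N by rewrite size_poly_gt0.
have extreme d : (euler_wronskian q)`_d != 0 -> d = (\sum_(j < k) j + r)%N.
  rewrite euler_wronskianE Wq -scalerAr -exprD coefZ coefXn.
  by have [//|_] := eqVneq d; rewrite mulr0 eqxx.
have top : (\sum_i (size (q i)).-1 = \sum_(j < k) j + r)%N.
  apply: extreme; apply: coef_euler_wronskian_neq0 => [i j ij|i|].
  - by apply: sz_inj; rewrite -(prednK (sgt i)) ij prednK.
  - by rewrite -lead_coefE lead_coef_eq0.
  - by left=> i; rewrite prednK.
have low : (\sum_i order0 (q i) = \sum_(j < k) j + r)%N.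
  apply: extreme; apply: coef_euler_wronskian_neq0 => // [i|].
    exact: coef_order0_neq0.
  by right=> i m; exact: order0_small.
have le i : (order0 (q i) <= (size (q i)).-1)%N.
  by rewrite -ltnS prednK // order0_lt_size.
have eq_or i : order0 (q i) = (size (q i)).-1.
  have /leqif_sum : forall l, true -> (order0 (q l) <= (size (q l)).-1
      ?= iff (order0 (q l) == (size (q l)).-1))%N by split.
  by rewrite low top => -[_]; rewrite eqxx => /esym /forallP /(_ i) /eqP.
have qE i : q i = lead_coef (q i) *: 'X^(order0 (q i)).
  apply/polyP => m; rewrite coefZ coefXn; case: eqVneq => [->|].
    by rewrite mulr1 lead_coefE eq_or.
  rewrite mulr0 neq_ltn => /orP[/order0_small //|hm].
  by rewrite nth_default // -(prednK (sgt i)) -eq_or.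
exists (diag_mx (\row_i (lead_coef (q i))^-1) *m A).
  rewrite unitmx_mul Au andbT unitmxE det_diag unitfE.
  by apply/prodf_neq0 => i _; rewrite mxE invr_eq0 lead_coef_eq0.
exists (fun i => order0 (q i)) => // i.
rewrite combine_mulmx (bigD1 i) //= [X in _ + X]big1 ?addr0 => [|j]; last first.
  by rewrite mxE eq_sym => /negbTE ->; rewrite mulr0n scale0r.
rewrite !mxE eqxx mulr1n -/(q i) [X in _ *: X]qE scalerA.
by rewrite mulVf ?scale1r // lead_coef_eq0.
Qed.

End AdaptedBasis.


(** * Covariance of the Wronskian *)

Section WronskianCovariance.
Context {C : numFieldType}.
Implicit Types (p q : {poly C}) (g : 'M[C]_2).

(** Chain rule for the substitution: the denominator [c X + d] times the
    derivative of the transform of [p], of weight [m], is a combination of the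
    transforms of [p] and of [p^`()]. *)
Lemma deriv_flt_poly m g p : \det g = 1 ->
  (g 1 0 *: 'X + (g 1 1)%:P) * (flt_poly m.+1 g p)^`()
  = (m.+1%:R * g 1 0) *: flt_poly m.+1 g p + flt_poly m g p^`().
Proof.
move=> dg.
set A := g 0 0 *: 'X + (g 0 1)%:P; set F := g 1 0 *: 'X + (g 1 1)%:P.
have dA : A^`() = (g 0 0)%:P by rewrite derivD derivZ derivX derivC addr0 alg_polyC.
have dF : F^`() = (g 1 0)%:P by rewrite derivD derivZ derivX derivC addr0 alg_polyC.
have det1 : (g 0 0)%:P * F - (g 1 0)%:P * A = 1.
  have -> : 1 = (\det g)%:P by rewrite dg.
  rewrite det2 /A /F -!mul_polyC !rmorphB !rmorphM /=; ring.
have -> : flt_poly m g p^`()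
    = \sum_(i < m.+2) p`_i *: (A ^+ i.-1 * F ^+ (m.+1 - i) *+ i).
  rewrite [RHS]big_ord_recl mulr0n scaler0 add0r; apply: eq_bigr => i _.
  by rewrite /= coef_deriv -scalerMnl -scalerMnr /bump add1n subSS.
rewrite /flt_poly -/A -/F linear_sum mulr_sumr scaler_sumr -big_split /=.
apply: eq_bigr => i _; rewrite derivZ -scalerAr.
rewrite [X in _ = X + _]scalerA [_ * p`_i]mulrC -scalerA -scalerDr.
congr (_ *: _).
have im : (m.+1 = i + (m.+1 - i))%N by rewrite subnKC // -ltnS.
have -> : m.+1%:R = i%:R + (m.+1 - i)%:R :> C by rewrite {1}im natrD.
move: (m.+1 - i)%N => j; rewrite derivM !deriv_exp dA dF.
have redF : F ^+ j *+ j = F * (F ^+ j.-1 *+ j).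
  by case: j => [|j] /=; rewrite ?mulr0n ?mulr0 // mulrnAr -exprS.
have redA : A ^+ i *+ i = A * (A ^+ i.-1 *+ i).
  by case: (i : nat) => [|i'] /=; rewrite ?mulr0n ?mulr0 // mulrnAr -exprS.
have {}det1 : (g 0 0)%:P * F = 1 + (g 1 0)%:P * A by rewrite -det1 subrK.
rewrite -mul_polyC rmorphM rmorphD /= (polyC_natr _ i) (polyC_natr _ j).
move: redF redA; rewrite -(mulr_natr (F ^+ j)) -(mulr_natr (F ^+ j.-1)).
rewrite -(mulr_natr (A ^+ i)) -(mulr_natr (A ^+ i.-1)) => redF redA.
transitivity ((g 0 0)%:P * F * (A ^+ i.-1 * i%:R) * F ^+ j
    + A ^+ i * (g 1 0)%:P * (F * (F ^+ j.-1 * j%:R))); first by ring.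
rewrite -redF det1.
transitivity ((A ^+ i.-1 * i%:R) * F ^+ j
  + (g 1 0)%:P * (A * (A ^+ i.-1 * i%:R)) * F ^+ j
  + A ^+ i * (g 1 0)%:P * (F ^+ j * j%:R)); first by ring.
by rewrite -redA; ring.
Qed.

(** Coefficients expressing the [j]-th derivative of the transform of [p],
    multiplied by the [j]-th power of the denominator, through the transforms of
    the derivatives of [p]; they do not depend on [p] and are unitriangular. *)
Fixpoint flt_deriv_coef (n : nat) (c : C) (j l : nat) : C :=
  if j is j'.+1 then
    ((n - l)%:R - j'%:R) * c * flt_deriv_coef n c j' l
    + (if l is l'.+1 then flt_deriv_coef n c j' l' else 0)
  else (l == 0)%:R.

Lemma flt_deriv_coef_triangular n c j l : (j < l)%N -> flt_deriv_coef n c j l = 0.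
Proof.
elim: j l => [|j IH] [|l] //= jl.
by rewrite !IH ?mulr0 ?add0r // (leq_trans _ jl).
Qed.

Lemma flt_deriv_coef_diag n c j : flt_deriv_coef n c j j = 1.
Proof.
elim: j => [|j IH] //=.
by rewrite flt_deriv_coef_triangular // mulr0 add0r.
Qed.

Lemma derivn_flt_poly n g p j : \det g = 1 -> (j <= n)%N ->
  (g 1 0 *: 'X + (g 1 1)%:P) ^+ j * (flt_poly n g p)^`(j)
  = \sum_(l < j.+1) flt_deriv_coef n (g 1 0) j l *: flt_poly (n - l) g p^`(l).
Proof.
move=> dg; set F := _ + _; set a := flt_deriv_coef n (g 1 0).
have dF : F^`() = (g 1 0)%:P by rewrite derivD derivZ derivX derivC addr0 alg_polyC.
elim: j => [|j IH] jn; first by rewrite big_ord1 /a /= scale1r mul1r subn0.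
have {}IH := IH (ltnW jn).
have step l : (l <= j)%N -> F * (flt_poly (n - l) g p^`(l))^`()
    = ((n - l)%:R * g 1 0) *: flt_poly (n - l) g p^`(l)
      + flt_poly (n - l.+1) g p^`(l.+1).
  move=> lj; have -> : (n - l)%N = (n - l.+1).+1 by rewrite subnSK // (leq_trans _ jn).
  by rewrite deriv_flt_poly.
have -> : F ^+ j.+1 * (flt_poly n g p)^`(j.+1)
    = F * (F ^+ j * (flt_poly n g p)^`(j))^`()
      - (j%:R * g 1 0) *: (F ^+ j * (flt_poly n g p)^`(j)).
  rewrite derivM deriv_exp dF derivnS -mul_polyC rmorphM /= (polyC_natr _ j).
  have redF : F ^+ j *+ j = F * (F ^+ j.-1 *+ j).
    by case: (j) => [|i] /=; rewrite ?mulr0n ?mulr0 // mulrnAr -exprS.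
  move: redF; rewrite -(mulr_natr (F ^+ j)) -(mulr_natr (F ^+ j.-1)) => redF.
  transitivity (F * F ^+ j * (flt_poly n g p)^`(j)^`()); first by rewrite -exprS.
  transitivity ((g 1 0)%:P * (flt_poly n g p)^`(j) * (F * (F ^+ j.-1 * j%:R))
    + F * F ^+ j * (flt_poly n g p)^`(j)^`()
    - j%:R * (g 1 0)%:P * (F ^+ j * (flt_poly n g p)^`(j))); last by ring.
  by rewrite -redF; ring.
rewrite IH linear_sum mulr_sumr scaler_sumr -sumrB.
transitivity (\sum_(l < j.+1) (((n - l)%:R - j%:R) * g 1 0 * a j l)
      *: flt_poly (n - l) g p^`(l)
    + \sum_(l < j.+1) a j l *: flt_poly (n - l.+1) g p^`(l.+1)).
  rewrite -big_split; apply: eq_bigr => l _ /=.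
  rewrite derivZ -scalerAr step; last by rewrite -ltnS.
  rewrite scalerDr !scalerA -addrA [_ + - _]addrC addrA -scalerBl; congr (_ *: _ + _).
  by ring.
under [RHS]eq_bigr do rewrite /a /= scalerDl.
rewrite big_split /=; congr (_ + _).
  rewrite [RHS]big_ord_recr /= flt_deriv_coef_triangular // mulr0 scale0r addr0.
  by [].
by rewrite [RHS]big_ord_recl /= scale0r add0r.
Qed.

Lemma sum_ord_double k : ((\sum_(j < k) j) + \sum_(j < k) j = k * k.-1)%N.
Proof.
elim: k => [|k IH]; first by rewrite !big_ord0.
rewrite !big_ord_recr /= addnACA IH; case: k {IH} => [|k] //=.
by rewrite addnn -muln2 -mulnDr addn2 mulnC.
Qed.

(** The Wronskian is a covariant: expanding derivatives of the transformed
    polynomials is a unitriangular change of columns, and what remains is the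
    Wronskian at the image point times a power of the denominator. *)
Lemma wronskian_flt n k g (p : 'I_k -> {poly C}) : \det g = 1 -> (k <= n.+1)%N ->
    (forall i, size (p i) <= n.+1)%N ->
    (size (wronskian p) <= (k * (n.+1 - k)).+1)%N ->
  wronskian (fun i => flt_poly n g (p i))
  = flt_poly (k * (n.+1 - k)) g (wronskian p).
Proof.
move=> dg kn sp sW; set N := (k * _)%N in sW *.
set F := g 1 0 *: 'X + (g 1 1)%:P.
have F0 : F != 0.
  apply/eqP => F0; have e i : F`_i = 0 by rewrite F0 coef0.
  have := e 0%N; have := e 1%N.
  rewrite /F !coefD !coefZ !coefX !coefC /= mulr1 mulr0 addr0 add0r => g10 g11.
  by move: dg; rewrite det2 g10 g11 !mulr0 subr0 => /eqP; rewrite eq_sym oner_eq0.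
pose a := flt_deriv_coef n (g 1 0).
pose M : 'M[{poly C}]_k := \matrix_(i, l) flt_poly (n - l) g (p i)^`(l).
have MW : \det M = F ^+ (\sum_(j < k) j) * wronskian (fun i => flt_poly n g (p i)).
  pose A : 'M[{poly C}]_k := \matrix_(j, l) (a j l)%:P.
  have dA : \det A = 1.
    rewrite det_trig; first by rewrite big1 // => i _; rewrite mxE /a flt_deriv_coef_diag.
    by apply/is_trig_mxP => i j ij; rewrite mxE /a flt_deriv_coef_triangular.
  rewrite -[LHS]mulr1 -dA -[in LHS](det_tr A) -det_mulmx.
  rewrite (_ : F ^+ _ = \det (diag_mx (\row_(j < k) F ^+ j))); last first.
    rewrite det_diag; under [RHS]eq_bigr do rewrite mxE.
    by elim/big_rec2: _ => [|i x y _ <-]; rewrite ?expr0 // exprD.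
  rewrite /wronskian mulrC -det_mulmx; congr (\det _); apply/matrixP => i j.
  rewrite mul_mx_diag !mxE mulrC derivn_flt_poly //; last first.
    by rewrite -ltnS (leq_trans (ltn_ord j)).
  rewrite -(big_mkord xpredT (fun l => a j l *: flt_poly (n - l) g (p i)^`(l))).
  under [LHS]eq_bigr do rewrite !mxE.
  rewrite -(big_mkord xpredT (fun l => flt_poly (n - l) g (p i)^`(l) * (a j l)%:P)).
  rewrite (big_cat_nat _ (n := j.+1)) //= [X in _ + X]big1_seq ?addr0.
    by apply: eq_bigr => l _; rewrite mulrC mul_polyC.
  move=> l; rewrite mem_index_iota => /andP[_ /andP[jl _]].
  by rewrite /a flt_deriv_coef_triangular // mulr0.
(* multiplying by [F] discards the point where the denominator vanishes *)
apply: (mulfI F0); apply: poly_horner_inj => z; rewrite !hornerM.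
have [->|Fz] := eqVneq F.[z] 0; first by rewrite !mul0r.
congr (_ * _); have Fz' : F.[z] = g 1 0 * z + g 1 1 by rewrite !hornerE.
pose w := (g 0 0 * z + g 0 1) / (g 1 0 * z + g 1 1).
have fltz m q : (size q <= m.+1)%N -> (flt_poly m g q).[z] = F.[z] ^+ m * q.[w].
  move=> sq; have := @horner_flt_poly _ m g (NPoly (sq : q \is a poly_of_size m.+1)) z.
  by rewrite Fz'; apply; rewrite -Fz'.
have := congr1 (horner^~ z) MW; rewrite hornerM horner_exp => {}MW.
apply: (mulfI (expf_neq0 (\sum_(j < k) j)%N Fz)); rewrite -MW fltz // mulrA -exprD.
have hdet (B : 'M[{poly C}]_k) x : (\det B).[x] = \det (map_mx (horner^~ x) B).
  by rewrite -!horner_evalE -det_map_mx; congr (\det _); apply/matrixP => i j; rewrite !mxE.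
rewrite /wronskian !hdet.
have -> : map_mx (horner^~ z) M = map_mx (horner^~ w) (\matrix_(i, j) (p i)^`(j))
     *m diag_mx (\row_(j < k) F.[z] ^+ (n - j)).
  apply/matrixP => i j; rewrite mul_mx_diag !mxE mulrC fltz //.
  apply/leq_sizeP => m hm; rewrite coef_derivn nth_default ?mul0rn //.
  apply: (leq_trans (sp i)); rewrite -(@subnKC j n) -1?addnS ?leq_add2l //.
  by rewrite -ltnS (leq_trans (ltn_ord j)).
rewrite det_mulmx mulrC; congr (_ * _).
rewrite det_diag; under eq_bigr do rewrite mxE.
have -> : \prod_(i < k) F.[z] ^+ (n - i) = F.[z] ^+ (\sum_(i < k) (n - i))%N.
  by elim/big_rec2: _ => [|i x y _ ->]; rewrite ?expr0 // exprD.
congr (_ ^+ _).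
have : (\sum_(i < k) (n - i) + \sum_(i < k) i = k * n)%N.
  rewrite -big_split /= (eq_bigr (fun=> n)) ?sum_nat_const ?card_ord // => i _.
  by rewrite subnK // -ltnS (leq_trans (ltn_ord i)).
have := sum_ord_double k; rewrite /N.
move: (\sum_(i < k) (n - i))%N (\sum_(i < k) i)%N => S T h1 h2.
have -> : (S = k * n - T)%N by rewrite -h2 addnK.
clear - kn h1 h2; case: k kn h1 h2 => [|k] kn h1 h2.
  by rewrite !mul0n addn0; case: T h1 h2.
rewrite subSS.
apply/eqP; rewrite -(eqn_add2r T) subnK; last by rewrite -h2 leq_addl.
rewrite addnAC h1 -mulnDr /=; apply/eqP; congr (_ * _)%N.
by rewrite subnKC.
Qed.

End WronskianCovariance.

(** * Monomial subspaces and monomial Wronskians *)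

Section MonomialSubspaces.
Context {C : numFieldType}.

Fact flt_act_is_linear m (g : 'M[C]_2) : linear (@flt_act C m g).
Proof.
move=> c p q; apply/val_inj => /=.
by rewrite flt_polyD flt_polyZ.
Qed.

HB.instance Definition _ m (g : 'M[C]_2) :=
  GRing.isLinear.Build C {poly_m.+1 C} {poly_m.+1 C} *:%R (@flt_act C m g)
    (@flt_act_is_linear m g).

Lemma val_npoly_sum n (I : Type) (r : seq I) (c : I -> C)
    (q : I -> {poly_n.+1 C}) :
  val (\sum_(i <- r) c i *: q i) = \sum_(i <- r) c i *: val (q i).
Proof. by rewrite linear_sum; apply: eq_bigr => i _; rewrite linearZ. Qed.

Lemma val_npolyp n i : (i <= n)%N ->
  val (npolyp n.+1 'X^i : {poly_n.+1 C}) = 'X^i.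
Proof. by move=> hi; apply: npolypK; rewrite size_polyXn. Qed.

(** Both implications compare the transformed Wronskian of [U] with the
    Wronskian of the transformed basis; the converse turns that basis into a
    basis of monomials. *)
Lemma proj_equiv_monomial_subspaceP n k (U : {vspace {poly_n.+1 C}})
    (Q : {poly_(k * (n.+1 - k)).+1 C}) :
    (k <= n.+1)%N -> wronskian_line U Q -> Q != 0 ->
  (exists2 M : {vspace {poly_n.+1 C}}, monomial_subspace k M & proj_equiv U M)
  <-> (exists2 g : 'M[C]_2, SL2 g &
       exists2 c : C, c != 0 & exists r,
         flt_poly (k * (n.+1 - k)) g Q = c *: 'X^r).
Proof.
move=> kn [e eU [c0 Qc]] Q0.
set N := (k * _)%N in Q Qc Q0 *.
set p := (fun i => _) in Qc.
have c00 : c0 != 0.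
  by apply: contraNneq Q0 => z; apply/eqP/val_inj; rewrite /= Qc z scale0r.
have sQ : (size (Q : {poly C}) <= N.+1)%N by case: (Q).
have WgQ g : SL2 g -> wronskian (fun i => flt_poly n g (p i))
    = c0^-1 *: flt_poly N g Q.
  move=> dg; rewrite Qc flt_polyZ scalerA mulVf // scale1r wronskian_flt //.
    by move=> i; rewrite /p; case: (tnth e i).
  by move: sQ; rewrite Qc size_scale.
split=> [[M [nu [snu srt nun ->]] [g dg Mg]]|[g dg [c c_neq0 [r gQ]]]].
  exists g => //; have gu := SL2_unit dg.
  have gQ0 : flt_poly N g Q != 0.
    apply: contraNneq Q0 => gQ0; apply/eqP/val_inj => /=.
    by rewrite -[LHS](flt_polyVK gu sQ) gQ0 flt_poly0.
  pose nut : k.-tuple nat := Tuple (introT eqP snu).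
  pose X : k.-tuple {poly_n.+1 C} := [tuple of map (fun i => npolyp n.+1 'X^i) nut].
  pose A : 'M[C]_k := \matrix_(i, j) coord X j (flt_act g (tnth e i)).
  have Xj (j : 'I_k) : val X`_j = 'X^(tnth nut j).
    rewrite (nth_map 0%N) ?snu // val_npolyp; last first.
      by apply: (allP nun); rewrite mem_nth ?snu.
    by rewrite (tnth_nth 0%N).
  have eA i : flt_poly n g (p i) = \sum_j A i j *: 'X^(tnth nut j).
    have : flt_act g (tnth e i) \in <<X>>%VS.
      suff : [set` <<X>>%VS] (flt_act g (tnth e i)) by [].
      by rewrite Mg; exists (tnth e i) => //=; rewrite (basis_mem eU) ?mem_tnth.
    move=> /coord_span /(congr1 val); rewrite val_npoly_sum => /= ->.
    by apply: eq_bigr => j _; rewrite mxE -Xj.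
  have nu_inj : injective (tnth nut).
    move=> i j; rewrite !(tnth_nth 0%N) /= => /eqP.
    by rewrite nth_uniq ?snu // ?(sorted_uniq ltn_trans ltnn) // => /eqP /val_inj.
  have [c c_neq0 [r Wnu]] := wronskian_monomials (C := C) nu_inj.
  have := WgQ g dg.
  rewrite (_ : (fun i => _) = fun i => \sum_j A i j *: 'X^(tnth nut j)); last first.
    by apply/funext => i; exact: eA.
  rewrite wronskian_mulmx Wnu scalerA => /esym /(congr1 (fun x => c0 *: x)).
  rewrite !scalerA divff // scale1r => gQ.
  exists (c0 * (\det A * c)); last by exists r.
  by apply: contraNneq gQ0 => z; rewrite gQ z scale0r.
have [||A Au [nu nu_inj Anu]] := @monomial_basis C k (fun i => flt_poly n g (p i)) (c0^-1 * c) r.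
- by rewrite mulf_neq0 ?invr_eq0.
- by rewrite WgQ // gQ scalerA.
have hnu i : (nu i <= n)%N.
  rewrite -ltnS -(size_polyXn C) -Anu; apply: (leq_trans (size_sum _ _ _)).
  apply/bigmax_leqP => j _; apply: (leq_trans (size_scale_leq _ _)).
  exact: (size_flt_poly n g (p j)).
pose s := sort leq (codom nu).
have ms i : (i \in s) = (i \in codom nu) by rewrite mem_sort.
pose f := linfun (@flt_act C n g).
have fU : (f @: U = <<[seq npolyp n.+1 'X^i | i <- s]>>)%VS.
  have fe i : flt_act g (tnth e i) = \sum_j invmx A i j *: npolyp n.+1 'X^(nu j).
    apply/val_inj; rewrite val_npoly_sum /=.
    transitivity (\sum_j (invmx A *m A) i j *: flt_poly n g (p j)).
      rewrite mulVmx // (bigD1 i) //= big1 ?addr0 ?mxE ?eqxx ?scale1r // => j.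
      by rewrite mxE eq_sym => /negbTE ->; rewrite scale0r.
    rewrite combine_mulmx; apply: eq_bigr => j _.
    by rewrite Anu; congr (_ *: _); rewrite [RHS](val_npolyp (hnu j)).
  apply/eqP; rewrite eqEsubv; apply/andP; split.
    rewrite -(span_basis eU) limg_span; apply/span_subvP => _ /mapP[u ue ->].
    have /tnthP[i ->] := ue; rewrite lfunE /= fe; apply: memv_suml => j _.
    apply: memvZ; apply: memv_span; apply/mapP; exists (nu j) => //.
    by rewrite ms codom_f.
  apply/span_subvP => x /mapP[m]; rewrite ms => /codomP[i ->] ->.
  apply/memv_imgP; exists (\sum_j A i j *: tnth e j).
    by apply: memv_suml => j _; rewrite memvZ ?(basis_mem eU) ?mem_tnth.
  rewrite lfunE /= linear_sum /=; apply/val_inj.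
  rewrite [LHS](val_npolyp (hnu i)) -Anu.
  under [in RHS]eq_bigr do rewrite linearZ.
  by rewrite val_npoly_sum.
exists (f @: U)%VS.
  exists s; split => //.
  - by rewrite size_sort size_codom card_ord.
  - rewrite ltn_sorted_uniq_leq sort_uniq sort_sorted ?andbT; last exact: leq_total.
    exact/injectiveP.
  - by apply/allP => m; rewrite ms => /codomP[i ->].
exists g => //; apply/seteqP; split=> [x /= /memv_imgP[u uU ->]|_ [u uU <-] /=].
  by exists u => //=; rewrite lfunE.
by apply/memv_imgP; exists u => //; rewrite lfunE.
Qed.

End MonomialSubspaces.

(** * Polynomials with one or two roots on the sphere *)

Section FewRoots.

Lemma card_eq1P (T : Type) (A : set T) :
  (A #= `I_1)%card <-> exists x, A = [set x].
Proof.
split=> [/eq_cardSP[x Ax]|[x ->]]; last exact: card_set1.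
rewrite II0 card_eq0 => /eqP Ax0; exists x; apply/seteqP; split=> [y Ay|y -> //].
by apply: contrapT => yx; have : set0 y by rewrite -Ax0; split.
Qed.

Lemma card_eq2P (T : Type) (A : set T) :
  (A #= `I_2)%card <-> exists x y, x <> y /\ A = [set x; y].
Proof.
split=> [/eq_cardSP[x Ax /card_eq1P[y Ay]]|[x [y [xy ->]]]].
  have [Ay' yx] : (A `\ x) y by rewrite Ay.
  exists x, y; split; first by move=> e; apply: yx.
  apply/seteqP; split=> [z Az|z [->|->]] //.
  have [->|zx] := pselect (z = x); first by left.
  by right; have : (A `\ x) z by []; rewrite Ay.
apply/eq_cardSP; exists x; first by left.
rewrite (_ : _ `\ x = [set y]) ?card_set1 //; apply/seteqP; split=> [z [[->|->]]|z ->] //.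
  by move=> /(_ erefl).
by split; [right|move=> e; apply: xy].
Qed.

Context {C : numClosedFieldType}.
Implicit Types (g : 'M[C]_2) (x y : sphere C).

Definition mx2 (a b c d : C) : 'M[C]_2 :=
  \matrix_(i, j) if i == 0 then if j == 0 then a else b
                 else if j == 0 then c else d.

Lemma mx2E a b c d : (mx2 a b c d 0 0 = a) * (mx2 a b c d 0 1 = b) *
  (mx2 a b c d 1 0 = c) * (mx2 a b c d 1 1 = d).
Proof. by rewrite !mxE. Qed.

Lemma det_mx2 a b c d : \det (mx2 a b c d) = a * d - b * c.
Proof. by rewrite det2 !mx2E. Qed.

Lemma vec_of_det_neq0 x y : x <> y ->
  vec_of x 0 0 * vec_of y 1 0 - vec_of y 0 0 * vec_of x 1 0 != 0.
Proof.
case: x y => [a|] [b|] xy; rewrite !mxE /= ?(mulr1, mul1r, mulr0, mul0r, subr0, sub0r) //.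
by rewrite subr_eq0; apply/eqP => e; apply: xy; rewrite e.
Qed.

Lemma SL2_two_points x y : x <> y ->
  exists2 g, SL2 g & mobius g None = x /\ mobius g (Some 0) = y.
Proof.
move=> xy; set D := vec_of x 0 0 * vec_of y 1 0 - vec_of y 0 0 * vec_of x 1 0.
have D0 : D != 0 := vec_of_det_neq0 xy.
pose g := mx2 (vec_of x 0 0) (vec_of y 0 0 / D) (vec_of x 1 0) (vec_of y 1 0 / D).
(* the second column is divided by [D] to bring the determinant to 1 *)
exists g; first by rewrite /SL2 /= det_mx2 mulrA [_ / D * _]mulrAC -mulrBl divff.
split; rewrite mobiusE.
  rewrite (_ : g *m _ = vec_of x) ?vec_ofK //.
  by apply: vec2P; rewrite mulmx2E !mx2E !mxE /= mulr1 mulr0 addr0.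
rewrite (_ : g *m _ = D^-1 *: vec_of y) ?pt_ofZ ?invr_eq0 ?vec_ofK //.
by apply: vec2P; rewrite mulmx2E !mx2E !mxE /= mulr1 mulr0 add0r mulrC.
Qed.

Lemma sphere_other x : exists y, x <> y.
Proof. by case: x => [a|]; [exists None|exists (Some 0)]. Qed.

Lemma poly_two_roots (P : {poly C}) a b : P != 0 ->
    (forall z, root P z -> z = a \/ z = b) ->
  exists p q, P = lead_coef P *: (('X - a%:P) ^+ p * ('X - b%:P) ^+ q)
    /\ (p + q = (size P).-1)%N.
Proof.
move=> P0 hr; have [r Pr] := closed_field_poly_normal P.
have lP : lead_coef P != 0 by rewrite lead_coef_eq0.
have szP : (size P).-1 = size r by rewrite Pr size_scale // size_prod_XsubC.
have {}hr z : z \in r -> z = a \/ z = b.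
  move=> zr; apply: hr; rewrite Pr rootE hornerZ mulf_eq0 -!rootE root_prod_XsubC zr.
  by rewrite orbT.
rewrite szP.
suff [p [q [e1 e2]]] : exists p q, \prod_(z <- r) ('X - z%:P)
    = ('X - a%:P) ^+ p * ('X - b%:P) ^+ q /\ (p + q = size r)%N.
  by exists p, q; rewrite -e1 -Pr.
elim: r hr {Pr szP} => [|z r IH] hr.
  by exists 0%N, 0%N; rewrite big_nil !expr0 mulr1.
have [|p [q [e1 e2]]] := IH; first by move=> t tr; apply: hr; rewrite inE tr orbT.
rewrite big_cons e1; have [->|->] := hr z (mem_head _ _).
  by exists p.+1, q; rewrite exprS mulrA /= -e2 addSn.
by exists p, q.+1; rewrite exprS mulrCA /= -e2 addnS.
Qed.

Lemma roots_flt_set m g (Q : {poly_m.+1 C}) : g \in unitmx -> Q != 0 ->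
  roots_in_sphere Q = mobius g @` roots_in_sphere (flt_act g Q).
Proof.
move=> gu Q0; apply/seteqP; split=> [x Qx|_ [x gQx <-]].
  exists (mobius (invmx g) x); last by rewrite mobiusVK.
  by apply/(roots_in_sphere_flt _ gu Q0); rewrite mobiusVK.
exact/(roots_in_sphere_flt _ gu Q0).
Qed.

Lemma roots_monomial m (P : {poly_m.+1 C}) (c : C) r :
    c != 0 -> P = c *: 'X^r :> {poly C} ->
  roots_in_sphere P = [set x | (x = Some 0 /\ (0 < r)%N) \/ (x = None /\ (r < m)%N)].
Proof.
move=> c0 Pr; apply/seteqP; split=> -[z|] /=; rewrite Pr.
- rewrite rootE !hornerE mulf_eq0 (negbTE c0) expf_eq0 /= => /andP[r0 /eqP ->].
  by left.
- by rewrite size_scale // size_polyXn subn_gt0 => rm; right.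
- case=> [[[->] r0]|[]//].
  by rewrite rootE !hornerE expr0n gtn_eqF // mulr0.
- by case=> [[]//|[_ rm]]; rewrite size_scale // size_polyXn subn_gt0.
Qed.

Lemma one_root_normal_form m g (Q : {poly_m.+1 C}) : Q != 0 -> SL2 g ->
    roots_in_sphere Q = [set mobius g None] ->
  exists2 c : C, c != 0 & flt_poly m g Q = c *: 'X^0.
Proof.
move=> Q0 dg rQ; have gu := SL2_unit dg.
have inj : injective (mobius g) := can_inj (mobiusK gu).
have fin z : ~~ root (flt_poly m g Q) z.
  apply/negP => gz; have : roots_in_sphere (flt_act g Q) (Some z) by [].
  move/(roots_in_sphere_flt _ gu Q0); rewrite rQ => /inj.
  by [].
have : ~~ (size (flt_poly m g Q) != 1).
  by apply/negP => /closed_rootP[z]; apply/negP.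
rewrite negbK => /size_poly1P[c c0 ->]; exists c => //.
by rewrite expr0 alg_polyC.
Qed.

Lemma two_roots_normal_form m g (Q : {poly_m.+1 C}) : Q != 0 -> SL2 g ->
    roots_in_sphere Q = [set mobius g None; mobius g (Some 0)] ->
  exists2 c : C, c != 0 &
    exists2 r, (0 < r < m)%N & flt_poly m g Q = c *: 'X^r.
Proof.
move=> Q0 dg rQ; have gu := SL2_unit dg.
have inj : injective (mobius g) := can_inj (mobiusK gu).
have sQ : (size (Q : {poly C}) <= m.+1)%N by case: (Q).
set P := flt_act g Q; have P0 : (P : {poly C}) != 0.
  apply: contraNneq Q0; rewrite /P /= => gQ0; apply/eqP/val_inj => /=.
  by rewrite -[LHS](flt_polyVK gu sQ) gQ0 flt_poly0.
have rP x : roots_in_sphere P x <-> x = None \/ x = Some 0.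
  split=> [/(roots_in_sphere_flt _ gu Q0)|h].
    by rewrite rQ => -[|] /inj; [left|right].
  by apply/(roots_in_sphere_flt _ gu Q0); rewrite rQ; case: h => ->; [left|right].
have [|p [q [e1 e2]]] := @poly_two_roots P 0 0 P0.
  by move=> z Pz; have /rP[//|[->]] : roots_in_sphere P (Some z) by []; left.
have {}e1 : flt_poly m g Q = lead_coef P *: 'X^((size (P : {poly C})).-1).
  by rewrite [LHS]e1 -e2 subr0 -exprD.
exists (lead_coef P); first by rewrite lead_coef_eq0.
exists (size (P : {poly C})).-1 => //; apply/andP; split; last first.
  by rewrite -subn_gt0; have /rP : @None C = None \/ @None C = Some 0 by left.
rewrite lt0n; apply/eqP => z.
have : roots_in_sphere P (Some 0) by apply/rP; right.
rewrite /roots_in_sphere /= e1 z expr0 rootE !hornerE.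
by rewrite lead_coef_eq0 (negbTE P0).
Qed.

(** Over an algebraically closed field the roots determine the polynomial up to
    a scalar and multiplicities, so moving a root to infinity and another one to
    0 leaves a monomial. *)
Lemma card_rootsP m (Q : {poly_m.+1 C}) : (0 < m)%N -> Q != 0 ->
  ((roots_in_sphere Q #= `I_1)%card \/ (roots_in_sphere Q #= `I_2)%card)
  <-> (exists2 g : 'M[C]_2, SL2 g & exists2 c : C, c != 0 & exists r,
         flt_poly m g Q = c *: 'X^r).
Proof.
move=> m0 Q0; split=> [[/card_eq1P[x Qx]|/card_eq2P[x [y [xy Qxy]]]]|].
- have [y xy] := sphere_other x; have [g dg [gx gy]] := SL2_two_points xy.
  exists g => //; have [|c c0 gQ] := one_root_normal_form Q0 dg; first by rewrite gx.
  by exists c => //; exists 0%N.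
- have [g dg [gx gy]] := SL2_two_points xy; exists g => //.
  have [|c c0 [r _ gQ]] := two_roots_normal_form Q0 dg; first by rewrite gx gy.
  by exists c => //; exists r.
move=> [g dg [c c0 [r gQ]]]; have gu := SL2_unit dg.
rewrite (roots_flt_set gu Q0) (@roots_monomial m (flt_act g Q) c r c0 gQ).
have inj : injective (mobius g) := can_inj (mobiusK gu).
have [r0|r0] := posnP r.
  left; apply/card_eq1P; exists (mobius g None); apply/seteqP; split=> x /=.
    by case=> y [[_]|[->] _ <-].
  by move=> ->; exists None => //; right; rewrite r0.
have [rm|mr] := ltnP r m.
  right; apply/card_eq2P; exists (mobius g None), (mobius g (Some 0)).
  split; first by move/inj.
  apply/seteqP; split=> x /=; first by case=> y [[->]|[->]] _ <-; [right|left].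
  by case=> ->; [exists None => //; right|exists (Some 0) => //; left].
left; apply/card_eq1P; exists (mobius g (Some 0)); apply/seteqP; split=> x /=.
  by case=> y [[->] _ <-|[_]].
by move=> ->; exists (Some 0) => //; left.
Qed.

End FewRoots.

(** * The covariants H and T *)

Section Covariants.
Context {C : numClosedFieldType}.
Implicit Types (P Q : {poly C}) (a b : C).

Lemma derivn2 Q : Q^`(2) = Q^`()^`(). Proof. by []. Qed.

Lemma derivn3 Q : Q^`(3) = Q^`()^`()^`(). Proof. by []. Qed.

Lemma cov_HE m Q : (0 < m)%N ->
  cov_H m Q = (m%:R - 1)%:P *
    (m%:R%:P * (Q * Q^`()^`()) - (m%:R - 1)%:P * Q^`() ^+ 2).
Proof.
move=> m0; have M0 : m%:R != 0 :> C by rewrite pnatr_eq0 -lt0n.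
rewrite /cov_H derivn2 -!mul_polyC mulrC [in LHS]mulrC rmorphM /=.
have -> : (m%:R - 1)%:P = m%:R%:P * ((m%:R - 1) / m%:R)%:P :> {poly C}.
  by rewrite -rmorphM /= mulrCA divff // mulr1.
ring.
Qed.

Lemma cov_TE m Q : (0 < m)%N ->
  cov_T m Q = - (m%:R - 1)%:P *
    (m%:R%:P ^+ 2 * (Q ^+ 2 * Q^`()^`()^`())
     - 3%:R * m%:R%:P * (m%:R - 2)%:P * (Q * Q^`() * Q^`()^`())
     + 2%:R * (m%:R - 1)%:P * (m%:R - 2)%:P * Q^`() ^+ 3).
Proof.
move=> m0; have M0 : m%:R != 0 :> C by rewrite pnatr_eq0 -lt0n.
rewrite /cov_T derivn2 derivn3 -!mul_polyC.
set x := m%:R in M0 *.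
have -> : 3 * ((x - 2) / x) = 3 * (x - 2) * x^-1 by ring.
have -> : 2 * ((x - 1) * (x - 2) / x ^+ 2) = 2 * (x - 1) * (x - 2) * x^-1 ^+ 2.
  by rewrite exprVn; ring.
have xV : x%:P * (x^-1)%:P = 1 :> {poly C} by rewrite -rmorphM /= divff.
rewrite !(rmorphM, rmorphN, rmorphXn) /= (polyC_natr _ 2) (polyC_natr _ 3).
set y := (x - 1)%:P; set z := (x - 2)%:P.
transitivity (- y * (x%:P ^+ 2 * (Q ^+ 2 * Q^`()^`()^`())
  - 3%:R * (x%:P * (x^-1)%:P) * x%:P * z * (Q * Q^`() * Q^`()^`())
  + 2%:R * (x%:P * (x^-1)%:P) ^+ 2 * y * z * Q^`() ^+ 3)); first by ring.
by rewrite xV expr1n !mulr1.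
Qed.

(** [T] is, up to sign, the first transvectant of [Q] and [H]: this is what
    ties the zeros of [T] to those of [H]. *)
Lemma cov_T_jacobian m Q : (0 < m)%N ->
  cov_T m Q = (2 * m%:R - 4)%:P * (Q^`() * cov_H m Q)
              - m%:R%:P * (Q * (cov_H m Q)^`()).
Proof.
move=> m0; rewrite cov_TE // cov_HE // !(derivM, derivB, derivC, deriv_exp).
set x := m%:R.
have -> : (x - 1)%:P = x%:P - 1 by rewrite rmorphB.
have -> : (x - 2)%:P = x%:P - 2%:R by rewrite rmorphB /= (polyC_natr _ 2).
have -> : (2 * x - 4)%:P = 2%:R * x%:P - 4%:R.
  by rewrite rmorphB rmorphM /= (polyC_natr _ 2) (polyC_natr _ 4).
ring.
Qed.

(** If [Q' / Q = s / w] then [H / Q^2] and [T / Q^3] are rational in [s] and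
    [w], with denominators [w^2] and [w^3]. *)
Lemma cov_logderiv m Q w s : (0 < m)%N -> w * Q^`() = s * Q ->
  let t := w * s^`() + s ^+ 2 - w^`() * s in
  w ^+ 2 * cov_H m Q =
    (m%:R - 1)%:P * (m%:R%:P * t - (m%:R - 1)%:P * s ^+ 2) * Q ^+ 2
  /\ w ^+ 3 * cov_T m Q = - (m%:R - 1)%:P *
    (m%:R%:P ^+ 2 * (w * t^`() + t * s - 2%:R * w^`() * t)
     - 3%:R * m%:R%:P * (m%:R - 2)%:P * (s * t)
     + 2%:R * (m%:R - 1)%:P * (m%:R - 2)%:P * s ^+ 3) * Q ^+ 3.
Proof.
move=> m0 e1 t.
have e2 : w ^+ 2 * Q^`()^`() = t * Q.
  have := congr1 (fun p => w * p^`()) e1; rewrite /= !derivM => e.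
  have -> : w ^+ 2 * Q^`()^`() = w * (w^`() * Q^`() + w * Q^`()^`()) - w^`() * (w * Q^`()).
    by ring.
  rewrite e mulrDr mulrA [w * (s * _)]mulrCA e1 /t; ring.
have e3 : w ^+ 3 * Q^`()^`()^`() = (w * t^`() + t * s - 2%:R * w^`() * t) * Q.
  have := congr1 (fun p => w * p^`()) e2; rewrite /= !derivM => e.
  have -> : w ^+ 3 * Q^`()^`()^`()
      = w * ((w^`() * w + w * w^`()) * Q^`()^`() + w ^+ 2 * Q^`()^`()^`())
        - 2%:R * w^`() * (w ^+ 2 * Q^`()^`()) by ring.
  rewrite e mulrDr mulrA [w * (t * _)]mulrCA e1 e2; ring.
rewrite cov_HE // cov_TE //.
move: (m%:R%:P) ((m%:R - 1)%:P) ((m%:R - 2)%:P) (w * t^`() + t * s - 2%:R * w^`() * t) e3 => x y z r e3.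
split.
  transitivity (y * (x * (Q * (w ^+ 2 * Q^`()^`())) - y * (w * Q^`()) ^+ 2)); first by ring.
  by rewrite e1 e2; ring.
transitivity (- y * (x ^+ 2 * (Q ^+ 2 * (w ^+ 3 * Q^`()^`()^`()))
  - 3%:R * x * z * (Q * (w * Q^`()) * (w ^+ 2 * Q^`()^`()))
  + 2%:R * y * z * (w * Q^`()) ^+ 3)); first by ring.
by rewrite e1 e2 e3; ring.
Qed.

(** If both quotients are constant then so is [T^2 / H^3], whose denominators
    [w^6] cancel. *)
Lemma cov_J2_of_const m Q w (h t : C) : w != 0 -> Q != 0 ->
    w ^+ 2 * cov_H m Q = h%:P * Q ^+ 2 -> w ^+ 3 * cov_T m Q = t%:P * Q ^+ 3 ->
  cov_H m Q = 0 \/ exists c : C, cov_J2 m Q = tofrac c%:P.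
Proof.
move=> w0 Q0 eH eT; have [H0|H0] := eqVneq (cov_H m Q) 0; [by left|right].
have h0 : h != 0.
  apply: contraNneq H0 => h0; move/eqP: eH.
  by rewrite h0 mul0r mulf_eq0 expf_eq0 /= (negbTE w0).
exists (t ^+ 2 / h ^+ 3); rewrite /cov_J2.
have H0' : tofrac (cov_H m Q) ^+ 3 != 0 by rewrite expf_neq0 // tofrac_eq0.
apply: (mulIf H0'); rewrite divfK // -!tofracXn -tofracM; congr tofrac.
have W0 : w ^+ 6 * h%:P ^+ 3 != 0 by rewrite mulf_neq0 ?expf_neq0 // polyC_eq0.
apply: (mulfI W0).
transitivity (h%:P ^+ 3 * (w ^+ 3 * cov_T m Q) ^+ 2); first by ring.
transitivity (h%:P ^+ 3 * (t ^+ 2 / h ^+ 3)%:P * (w ^+ 2 * cov_H m Q) ^+ 3); last by ring.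
have -> : h%:P ^+ 3 * (t ^+ 2 / h ^+ 3)%:P = t%:P ^+ 2.
  by rewrite -!rmorphXn -rmorphM /= mulrCA divff ?expf_neq0 // mulr1.
by rewrite eH eT; ring.
Qed.

Lemma deriv_lin a : ('X - a%:P)^`() = 1 :> {poly C}.
Proof. by rewrite derivB derivX derivC subr0. Qed.

Lemma XsubC_deriv_exp a p :
  ('X - a%:P) * (('X - a%:P) ^+ p)^`() = p%:R%:P * ('X - a%:P) ^+ p.
Proof.
rewrite deriv_exp deriv_lin mul1r (polyC_natr _ p) mulr_natl mulrnAr.
by case: p => [|p]; rewrite ?mulr0n // -exprS.
Qed.

(** Here [Q' / Q = p / (X - a)], so [s] is constant; [p] may be smaller than
    [m], the remaining roots being at infinity. *)
Lemma cov_J2_one_root m (c : C) a p : (0 < m)%N -> c != 0 ->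
  let Q := c *: ('X - a%:P) ^+ p in
  cov_H m Q = 0 \/ exists j : C, cov_J2 m Q = tofrac j%:P.
Proof.
move=> m0 c0 Q; set u := 'X - a%:P in Q *.
have u0 : u != 0 by rewrite polyXsubC_eq0.
have e : u * Q^`() = p%:R%:P * Q.
  by rewrite derivZ -!scalerAr XsubC_deriv_exp.
have [eH eT] := cov_logderiv m0 e.
rewrite !derivC mulr0 add0r deriv_lin mul1r in eH eT.
move: (m%:R : C) (p%:R : C) eH eT => x s eH eT.
apply: (@cov_J2_of_const m Q u ((x - 1) * (x * (s ^+ 2 - s) - (x - 1) * s ^+ 2))
  (- (x - 1) * (x ^+ 2 * ((s ^+ 2 - s) * s - 2%:R * (s ^+ 2 - s))
     - 3%:R * x * (x - 2) * (s * (s ^+ 2 - s)) + 2%:R * (x - 1) * (x - 2) * s ^+ 3))) => //.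
- by rewrite scaler_eq0 negb_or c0 expf_neq0.
- by rewrite eH; congr (_ * _); rewrite !(polyC_natr _ 2, polyC_natr _ 3, rmorph1, rmorphXn, rmorphN, rmorphB, rmorphM, rmorphD) /=; ring.
rewrite eT; congr (_ * _); rewrite -!rmorphXn -!rmorphB /= derivC.
by rewrite !(polyC_natr _ 2, polyC_natr _ 3, rmorph1, rmorphXn, rmorphN, rmorphB, rmorphM, rmorphD) /=; ring.
Qed.

(** With [w = (X - a) (X - b)] the numerator [s] has degree 1, and the condition
    [p + q = m] makes every nonconstant term cancel. *)
Lemma cov_J2_two_roots m (c : C) a b p q : (0 < m)%N -> c != 0 -> (p + q = m)%N ->
  let Q := c *: (('X - a%:P) ^+ p * ('X - b%:P) ^+ q) in
  cov_H m Q = 0 \/ exists j : C, cov_J2 m Q = tofrac j%:P.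
Proof.
move=> m0 c0 pqm Q; set u := 'X - a%:P in Q *; set v := 'X - b%:P in Q *.
have u0 : u != 0 by rewrite polyXsubC_eq0.
have v0 : v != 0 by rewrite polyXsubC_eq0.
set d := a - b; have vE : v = u + d%:P by rewrite /v /u /d rmorphB /=; ring.
set x := (m%:R : C); set s := (p%:R : C).
have qE : q%:R = x - s :> C by rewrite /x /s -pqm natrD addrAC subrr add0r.
have e : u * v * Q^`() = (x%:P * u + s%:P * d%:P) * Q.
  rewrite derivZ derivM -!scalerAr; congr (_ *: _).
  transitivity (v * (u * (u ^+ p)^`()) * v ^+ q + u * u ^+ p * (v * (v ^+ q)^`())).
    by ring.
  by rewrite !XsubC_deriv_exp -/u -/v -/s qE vE [(x - s)%:P]rmorphB /=; ring.
have [eH eT] := cov_logderiv m0 e.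
have dw : (u * v)^`() = 2%:R * u + d%:P by rewrite derivM !deriv_lin vE; ring.
have ds : (x%:P * u + s%:P * d%:P)^`() = x%:P.
  by rewrite derivD !derivM !derivC deriv_lin; ring.
rewrite dw ds in eH eT.
have dt : (u * v * x%:P + (x%:P * u + s%:P * d%:P) ^+ 2
    - (2%:R * u + d%:P) * (x%:P * u + s%:P * d%:P))^`() =
    (2%:R * u + d%:P) * x%:P + 2%:R * (x%:P * u + s%:P * d%:P) * x%:P
    - 2%:R * (x%:P * u + s%:P * d%:P) - (2%:R * u + d%:P) * x%:P.
  rewrite -(polyC_natr _ 2) expr2 !(derivB, derivD, derivM, derivC, derivX).
  by rewrite -/u -/v vE (polyC_natr _ 2); ring.
rewrite dt vE -/x in eH eT.
move: x s d {qE e dw ds dt} vE eH eT => x s d vE eH eT.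
apply: (@cov_J2_of_const m Q (u * v)
  ((x - 1) * (x * (s ^+ 2 - s) - (x - 1) * s ^+ 2) * d ^+ 2)
  (- (x - 1) * (x ^+ 2 * ((s ^+ 2 - s) * s - 2%:R * (s ^+ 2 - s))
     - 3%:R * x * (x - 2) * (s * (s ^+ 2 - s)) + 2%:R * (x - 1) * (x - 2) * s ^+ 3)
   * d ^+ 3)) => //.
- by rewrite mulf_neq0.
- by rewrite scaler_eq0 negb_or c0 mulf_neq0 ?expf_neq0.
- rewrite {1}vE eH; congr (_ * _).
  by rewrite !(polyC_natr _ 2, polyC_natr _ 3, rmorph1, rmorphXn, rmorphN, rmorphB, rmorphM, rmorphD) /=; ring.
rewrite {1}vE eT; congr (_ * _).
by rewrite !(polyC_natr _ 2, polyC_natr _ 3, rmorph1, rmorphXn, rmorphN, rmorphB, rmorphM, rmorphD) /=; ring.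
Qed.

End Covariants.

(** * Multiplicities and degree of H *)

Section CovariantRoots.
Context {C : numClosedFieldType}.
Implicit Types (P Q : {poly C}) (a b : C).

Lemma mup_factor P a : P != 0 ->
  exists2 r, ~~ root r a & P = r * ('X - a%:P) ^+ mup a P.
Proof.
move=> P0; have [n [r]] := multiplicity_XsubC P a; rewrite P0 /= => ra Pr.
exists r => //; rewrite {1}Pr; congr (_ * _ ^+ _).
by rewrite Pr mupMr // mup_XsubCX eqxx.
Qed.

Lemma mup_exp P a n : P != 0 -> mup a (P ^+ n) = (n * mup a P)%N.
Proof.
move=> P0; elim: n => [|n IH]; first by rewrite expr0 mupNroot // root1.
by rewrite exprS mupM ?expf_neq0 // IH mulSn.
Qed.

Lemma mup_scale P a (c : C) : c != 0 -> mup a (c *: P) = mup a P.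
Proof. by move=> c0; rewrite -mul_polyC mupMr // rootC. Qed.

Lemma XsubC_deriv_factor a (r : {poly C}) p :
  ('X - a%:P) * (r * ('X - a%:P) ^+ p)^`()
  = (('X - a%:P) * r^`() + p%:R%:P * r) * ('X - a%:P) ^+ p.
Proof.
rewrite derivM mulrDr [X in _ + X]mulrCA XsubC_deriv_exp; ring.
Qed.

(** At a root of multiplicity [0 < p < m] the leading terms in [H] combine to
    [p (p - m)], which does not vanish: [H] has multiplicity exactly [2 p - 2]. *)
Lemma mup_cov_H m Q a : Q != 0 -> (0 < mup a Q < m)%N ->
  cov_H m Q != 0 /\ (mup a (cov_H m Q) + 2 = 2 * mup a Q)%N.
Proof.
move=> Q0 /andP[p0 pm]; have [r ra Qr] := mup_factor a Q0.
have m0 : (0 < m)%N by apply: leq_trans pm.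
have m1 : m%:R - 1 != 0 :> C.
  by rewrite subr_eq0 (eqr_nat _ m 1) gtn_eqF // (leq_trans _ pm).
set p := mup a Q in Qr p0 pm *; set u := 'X - a%:P in Qr.
have u0 : u != 0 by rewrite polyXsubC_eq0.
have ua : u.[a] = 0 by rewrite /u !hornerE subrr.
pose s0 := u * r^`() + p%:R%:P * r.
have e1 : u * Q^`() = s0 * u ^+ p by rewrite Qr XsubC_deriv_factor.
pose s1 := u * s0^`() + p%:R%:P * s0 - s0.
have e2 : u ^+ 2 * Q^`()^`() = s1 * u ^+ p.
  have := congr1 (fun q => u * q^`()) e1; rewrite /= XsubC_deriv_factor derivM -/u.
  rewrite deriv_lin mul1r => e.
  have -> : u ^+ 2 * Q^`()^`() = u * (Q^`() + u * Q^`()^`()) - u * Q^`() by ring.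
  by rewrite e e1 /s1; ring.
have s0a : s0.[a] = p%:R * r.[a] by rewrite /s0 hornerD !hornerM ua hornerC mul0r add0r.
have s1a : s1.[a] = (p%:R - 1) * (p%:R * r.[a]).
  by rewrite /s1 hornerD hornerN hornerD !hornerM hornerC s0a ua; ring.
clearbody s1 s0.
pose B := (m%:R - 1)%:P * (m%:R%:P * (r * s1) - (m%:R - 1)%:P * s0 ^+ 2).
have eH : u ^+ 2 * cov_H m Q = B * u ^+ (2 * p).
  rewrite cov_HE //.
  transitivity ((m%:R - 1)%:P * (m%:R%:P * (Q * (u ^+ 2 * Q^`()^`()))
     - (m%:R - 1)%:P * (u * Q^`()) ^+ 2)); first by ring.
  by rewrite e1 e2 {1}Qr /B mulnC exprM; ring.
have Ba : ~~ root B a.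
  have e : B.[a] = (m%:R - 1) * (p%:R * (p%:R - m%:R)) * r.[a] ^+ 2.
    by rewrite /B !(hornerD, hornerN, hornerM, horner_exp, hornerC) s0a s1a; ring.
  rewrite rootE e !mulf_neq0 //.
    by rewrite pnatr_eq0 -lt0n.
  by rewrite subr_eq0 eqr_nat ltn_eqF.
have H0 : cov_H m Q != 0.
  apply: contraNneq Ba => H0; move/eqP: eH.
  by rewrite H0 mulr0 eq_sym mulf_eq0 expf_eq0 (negbTE u0) andbF orbF => /eqP ->; rewrite root0.
split=> //; move/(congr1 (mup a)): eH.
by rewrite mupM ?expf_neq0 // (mupMr _ Ba) /u !mup_XsubCX eqxx addnC.
Qed.

(** At a zero of [H] away from the roots of [Q], the transvectant formula makes
    the multiplicity of [T] one less than that of [H]; then [T^2] and [H^3]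
    cannot be proportional. *)
Lemma root_cov_H m Q (c : C) b : (0 < m)%N -> cov_H m Q != 0 ->
    cov_T m Q ^+ 2 = c *: cov_H m Q ^+ 3 -> root (cov_H m Q) b -> root Q b.
Proof.
move=> m0 H0 TH Hb; apply: contraT => Qb.
have := cov_T_jacobian Q m0; move: (cov_T m Q) TH => T TH.
have h0 : (0 < mup b (cov_H m Q))%N by rewrite -XsubC_dvd // dvdp_XsubCl.
have [r rb Hr] := mup_factor b H0.
move: (cov_H m Q) H0 TH Hb h0 Hr => H H0 TH Hb h0 Hr eT.
set h := mup b H in h0 Hr.
set u := 'X - b%:P in Hr.
have u0 : u != 0 by rewrite polyXsubC_eq0.
pose B := (2 * m%:R - 4)%:P * (Q^`() * (u * r)) - m%:R%:P * (Q * (u * r^`() + h%:R%:P * r)).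
have eB : u * T = B * u ^+ h.
  transitivity ((2 * m%:R - 4)%:P * (Q^`() * (u * H)) - m%:R%:P * (Q * (u * H^`()))).
    by rewrite eT; ring.
  by rewrite {2}Hr XsubC_deriv_factor -/u {1}Hr /B; ring.
have Bb : ~~ root B b.
  have e : B.[b] = - (m%:R * (Q.[b] * (h%:R * r.[b]))).
    by rewrite /B /u !hornerE /=; ring.
  by rewrite rootE e oppr_eq0 !mulf_neq0 // pnatr_eq0 -lt0n.
have B0 : B != 0 by apply: contraNneq Bb => ->; rewrite root0.
have T0 : T != 0.
  by apply: contraNneq (mulf_neq0 B0 (expf_neq0 h u0)) => T0; rewrite -eB T0 mulr0.
have c0 : c != 0.
  by apply: contraNneq T0 => c0; move/eqP: TH; rewrite c0 scale0r expf_eq0.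
have := congr1 (mup b) eB.
rewrite mupM // (mupMr _ Bb) -[u in mup b u]expr1 /u !mup_XsubCX eqxx => e1.
have := congr1 (mup b) TH; rewrite mup_scale // !mup_exp // -/h -e1.
lia.
Qed.

Lemma coef_mul_top P Q (a b : nat) : (size P <= a.+1)%N -> (size Q <= b.+1)%N ->
  (size (P * Q)%R <= (a + b).+1)%N /\ (P * Q)`_(a + b) = P`_a * Q`_b.
Proof.
move=> sP sQ.
have [|] := @coef_prod_top C bool [:: true; false] (fun x => if x then a else b)
  (fun x => if x then P else Q); first by case.
by rewrite !big_cons !big_nil !mulr1 !addn0.
Qed.

Lemma size_coef_top P n : (size P <= n.+1)%N -> P`_n != 0 -> size P = n.+1.
Proof.
move=> sP Pn; apply/eqP; rewrite eqn_leq sP ltnNge /=.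
by apply: contraNN Pn => h; rewrite nth_default.
Qed.

Lemma coef_X_deriv P n : ('X * P^`())`_n = n%:R * P`_n.
Proof. by have := coef_Xn_derivn P 1 n; rewrite expr1 derivn1 ffactn1. Qed.

Lemma size_X_deriv P n : (size P <= n.+1)%N -> (size ('X * P^`())%R <= n.+1)%N.
Proof.
by move=> sP; apply/leq_sizeP => j hj; rewrite coef_X_deriv nth_default ?mulr0 // (leq_trans sP).
Qed.

(** The computation of [mup_cov_H] at infinity, with the Euler operator
    [X d/dX], which preserves degrees, in place of the derivative. *)
Lemma size_cov_H m Q D : size Q = D.+1 -> (0 < D < m)%N ->
  cov_H m Q != 0 /\ (size (cov_H m Q)).-1.+2 = (2 * D)%N.
Proof.
move=> sQ /andP[D0 Dm]; have m0 : (0 < m)%N by apply: leq_trans Dm.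
have m1 : m%:R - 1 != 0 :> C.
  by rewrite subr_eq0 (eqr_nat _ m 1) gtn_eqF // (leq_trans _ Dm).
have QD : Q`_D != 0.
  by have := lead_coef_eq0 Q; rewrite lead_coefE sQ /= => ->; rewrite -size_poly_eq0 sQ.
have sQ' : (size Q <= D.+1)%N by rewrite sQ.
have sQ1 := size_X_deriv sQ'.
have e2 : 'X^2 * Q^`()^`() = 'X * ('X * Q^`())^`() - 'X * Q^`() :> {poly C}.
  by rewrite derivM derivX; ring.
have sQ2 : (size ('X^2 * Q^`()^`())%R <= D.+1)%N.
  rewrite e2 (leq_trans (size_polyD _ _)) // geq_max size_polyN sQ1 andbT.
  exact: size_X_deriv.
have eH : 'X^2 * cov_H m Q = (m%:R - 1)%:P * (m%:R%:P * (Q * ('X^2 * Q^`()^`()))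
    - (m%:R - 1)%:P * ('X * Q^`() * ('X * Q^`()))).
  by rewrite cov_HE //; ring.
have [s1 c1] := coef_mul_top sQ' sQ2.
have [s2 c2] := coef_mul_top sQ1 sQ1.
have sH : (size ('X^2 * cov_H m Q)%R <= (D + D).+1)%N.
  rewrite eH !mul_polyC (leq_trans (size_scale_leq _ _)) //.
  rewrite (leq_trans (size_polyD _ _)) // geq_max size_polyN.
  by rewrite !(leq_trans (size_scale_leq _ _)).
have cH : ('X^2 * cov_H m Q)`_(D + D) != 0.
  rewrite eH coefCM coefB !coefCM c1 c2 e2 coefB !coef_X_deriv.
  have -> : m%:R * (Q`_D * (D%:R * (D%:R * Q`_D) - D%:R * Q`_D))
     - (m%:R - 1) * (D%:R * Q`_D * (D%:R * Q`_D))
     = D%:R * (D%:R - m%:R) * Q`_D ^+ 2 by ring.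
  rewrite !mulf_neq0 //; first by rewrite pnatr_eq0 -lt0n.
  by rewrite subr_eq0 eqr_nat ltn_eqF.
have H0 : cov_H m Q != 0.
  by apply: contraNneq cH => ->; rewrite mulr0 coef0.
split=> //; have := size_coef_top sH cH.
rewrite mulrC size_mulXn //; have : (0 < size (cov_H m Q))%N by rewrite size_poly_gt0.
by case: (size _) => //= sz _ []; rewrite addnn mul2n => <-.
Qed.

(** When the top coefficient of [X T] predicted by the transvectant formula is
    nonzero, which fails only for [deg H + 4 = 2 m], it fixes the degree of
    [T], and [T^2 = c H^3] then forces the other value. *)
Lemma size_cov_T m Q (c : C) : (0 < m)%N -> size Q = m.+1 -> cov_H m Q != 0 ->
    cov_T m Q ^+ 2 = c *: cov_H m Q ^+ 3 ->
  let E := (size (cov_H m Q)).-1 in (E + 4 = 2 * m)%N \/ (E + 2 = 2 * m)%N.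
Proof.
move=> m0 sQ H0 TH E; have [e4|e4] := eqVneq (E + 4)%N (2 * m)%N; [by left|right].
have sH : size (cov_H m Q) = E.+1 by rewrite /E prednK // size_poly_gt0.
have := cov_T_jacobian Q m0; move: (cov_T m Q) (cov_H m Q) TH H0 sH => T H TH H0 sH eT.
have Qm : Q`_m != 0.
  by have := lead_coef_eq0 Q; rewrite lead_coefE sQ /= => ->; rewrite -size_poly_eq0 sQ.
have HE : H`_E != 0.
  by have := lead_coef_eq0 H; rewrite lead_coefE sH /= => ->.
have sQ' : (size Q <= m.+1)%N by rewrite sQ.
have sH' : (size H <= E.+1)%N by rewrite sH.
have [s1 c1] := coef_mul_top (size_X_deriv sQ') sH'.
have [s2 c2] := coef_mul_top sQ' (size_X_deriv sH').
have {}eT : 'X * T = (2 * m%:R - 4)%:P * ('X * Q^`() * H) - m%:R%:P * (Q * ('X * H^`())).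
  by rewrite eT; ring.
have sT : (size ('X * T)%R <= (m + E).+1)%N.
  rewrite eT !mul_polyC (leq_trans (size_polyD _ _)) // geq_max size_polyN.
  by rewrite !(leq_trans (size_scale_leq _ _)).
have cT : ('X * T)`_(m + E) != 0.
  rewrite eT coefB !coefCM c1 c2 !coef_X_deriv.
  have -> : (2 * m%:R - 4) * (m%:R * Q`_m * H`_E) - m%:R * (Q`_m * (E%:R * H`_E))
    = m%:R * ((2 * m)%:R - (E + 4)%:R) * (Q`_m * H`_E).
    by rewrite natrM natrD; ring.
  rewrite !mulf_neq0 ?pnatr_eq0 -?lt0n // subr_eq0 eqr_nat.
  by rewrite eq_sym.
have T0 : T != 0 by apply: contraNneq cT => ->; rewrite mulr0 coef0.
have c0 : c != 0.
  by apply: contraNneq T0 => c0; move/eqP: TH; rewrite c0 scale0r expf_eq0.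
have := size_coef_top sT cT; rewrite mulrC size_mulX // => -[sT'].
have := congr1 (fun p : {poly C} => (size p).-1) TH; rewrite /= size_scale //.
rewrite !size_exp sH sT' /=.
lia.
Qed.

End CovariantRoots.

(** * The covariant criterion *)

Section CovariantCriterion.
Context {C : numClosedFieldType}.
Implicit Types (P : {poly C}).

Lemma sum_count_mem (T : eqType) (ds r : seq T) :
  uniq ds -> {subset r <= ds} -> (\sum_(z <- ds) count_mem z r = size r)%N.
Proof.
move=> uds; elim: r => [|x r IH] sub; first by rewrite big1.
rewrite /= big_split /= IH => [|y yr]; last by rewrite sub // inE yr orbT.
rewrite (_ : \sum_(z <- ds) (x == z) = count_mem x ds)%N; last first.
  by elim: ds {uds sub IH} => [|y ds IHd]; rewrite ?big_nil // big_cons IHd /= eq_sym.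
by rewrite count_uniq_mem // sub ?mem_head.
Qed.

Lemma sum_mup P (ds : seq C) : P != 0 -> uniq ds ->
    (forall z, root P z -> z \in ds) ->
  (\sum_(z <- ds) mup z P = (size P).-1)%N.
Proof.
move=> P0 uds hr; have [r Pr] := closed_field_poly_normal P.
have lP : lead_coef P != 0 by rewrite lead_coef_eq0.
rewrite {2}Pr size_scale // size_prod_XsubC /= -(@sum_count_mem _ ds r) //.
  by apply: eq_bigr => z _; rewrite Pr mup_scale // mu_prod_XsubC.
move=> z zr; apply: hr; rewrite Pr rootE hornerZ mulf_eq0 -!rootE.
by rewrite root_prod_XsubC zr orbT.
Qed.

Lemma roots_in_sphere_finite m (Q : {poly_m.+1 C}) : Q != 0 ->
  exists ds : seq C, [/\ uniq ds, (forall z, root Q z = (z \in ds)) &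
    roots_in_sphere Q = [set x | (exists2 z, z \in ds & x = Some z) \/
      (x = None /\ (size (Q : {poly C}) <= m)%N)]].
Proof.
move=> Q0; have Q0' : (Q : {poly C}) != 0 by [].
have [r Qr] := closed_field_poly_normal (Q : {poly C}).
have lQ : lead_coef Q != 0 by rewrite lead_coef_eq0.
have hr z : root Q z = (z \in undup r).
  rewrite mem_undup {1}Qr rootE hornerZ mulf_eq0 (negbTE lQ) /= -root_prod_XsubC.
  by rewrite rootE.
exists (undup r); split => //; first exact: undup_uniq.
have sQ : (0 < size (Q : {poly C}))%N by rewrite size_poly_gt0.
apply/seteqP; split=> -[z|]; rewrite /roots_in_sphere /=.
- by rewrite hr => zr; left; exists z.
- by rewrite subn_gt0 prednK // => h; right.
- by case=> [[z' zr [->]]|[]//]; rewrite hr.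
- by case=> [[]//|[_ h]]; rewrite subn_gt0 prednK.
Qed.

(** With [d] distinct finite roots, [H] has degree [2 (deg Q - d)], because its
    only zeros are those of [Q].  Comparing with the degree predicted by the
    leading terms leaves [d <= 1], or [d = 2] and no root at infinity. *)
Lemma few_roots_of_cov m (Q : {poly_m.+1 C}) : (0 < m)%N -> Q != 0 ->
    cov_H m Q = 0 \/ (exists c : C, cov_J2 m Q = tofrac c%:P) ->
  (roots_in_sphere Q #= `I_1)%card \/ (roots_in_sphere Q #= `I_2)%card.
Proof.
move=> m0 Q0 hyp; have Q0' : (Q : {poly C}) != 0 by [].
have [ds [uds hds ->]] := roots_in_sphere_finite Q0.
have sQ : (size (Q : {poly C}) <= m.+1)%N by case: (Q).
set D := (size (Q : {poly C})).-1.
have sD : size (Q : {poly C}) = D.+1 by rewrite /D prednK // size_poly_gt0.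
have Dm : (D <= m)%N by rewrite -ltnS -sD.
have sumQ : (\sum_(z <- ds) mup z Q = D)%N.
  by rewrite (sum_mup Q0' uds) // => z; rewrite hds.
have mup_gt0 z : z \in ds -> (0 < mup z Q)%N.
  by rewrite -hds -XsubC_dvd // dvdp_XsubCl.
have mup_le z : z \in ds -> (mup z Q <= D)%N.
  by move=> zds; rewrite -sumQ (big_rem z) //= leq_addr.
have size_ds : (size ds <= D)%N.
  rewrite -sumQ -sum1_size big_seq [X in (_ <= X)%N]big_seq.
  by apply: leq_sum => z /mup_gt0.
have one_full z : z \in ds -> mup z Q = D -> size ds = 1%N.
  move=> zds full; move: sumQ; rewrite (big_rem z) //= full => /eqP.
  rewrite -[X in _ == X]addn0 eqn_add2l => /eqP s0.
  rewrite (perm_size (perm_to_rem zds)) /=; congr _.+1; apply/eqP; rewrite -leqn0 -s0.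
  rewrite -sum1_size big_seq [X in (_ <= X)%N]big_seq.
  by apply: leq_sum => y /mem_rem /mup_gt0.
have propT : cov_H m Q != 0 ->
    exists c : C, cov_T m Q ^+ 2 = c *: cov_H m Q ^+ 3.
  move=> H0; case: hyp => [/eqP|[c J2]]; first by rewrite (negbTE H0).
  exists c; have H0' : tofrac (cov_H m Q) ^+ 3 != 0 by rewrite expf_neq0 // tofrac_eq0.
  apply/eqP; rewrite -tofrac_eq -mul_polyC tofracXn tofracM tofracXn.
  by rewrite -J2 /cov_J2 divfK.
have sumH : cov_H m Q != 0 -> (forall z, z \in ds -> mup z Q < m)%N ->
    ((size (cov_H m Q)).-1 + 2 * size ds = 2 * D)%N.
  move=> H0 lt; have [c TH] := propT H0.
  rewrite -(sum_mup H0 uds); last first.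
    by move=> z Hz; rewrite -hds; exact: root_cov_H m0 H0 TH Hz.
  rewrite -sumQ -sum1_size !big_distrr /= -big_split /= big_seq [RHS]big_seq.
  apply: eq_bigr => z zds; rewrite muln1.
  have /(mup_cov_H Q0')[_ <- //] : (0 < mup z Q < m)%N by rewrite mup_gt0 // lt.
have None_iff : (size (Q : {poly C}) <= m)%N = (D < m)%N by rewrite sD.
rewrite None_iff; have [D0|D0] := posnP D.
  left; apply/card_eq1P; exists None; apply/seteqP; split=> x /=.
    case=> [[z zds _]|[-> //]].
    by have := mup_le z zds; rewrite D0 leqn0 => /eqP z0; have := mup_gt0 z zds; rewrite z0.
  by move=> ->; right; rewrite D0.
have ds0 : (0 < size ds)%N.
  case: (ds) sumQ => [|//]; rewrite big_nil => e.
  by move: D0; rewrite -e.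
have [Dltm|mleD] := ltnP D m.
  have [H0 sH] : cov_H m Q != 0 /\ (size (cov_H m Q)).-1.+2 = (2 * D)%N.
    by apply: size_cov_H; rewrite ?D0.
  have := sumH H0 (fun z zds => leq_ltn_trans (mup_le z zds) Dltm).
  rewrite -sH => e; have : size ds = 1%N by lia.
  case: (ds) => [|a [|]] // _.
  right; apply/card_eq2P; exists None, (Some a); split=> //.
  apply/seteqP; split=> x /=.
    by case=> [[z]|[-> _]]; [rewrite inE => /eqP -> ->; right|left].
  by case=> ->; [right|left; exists a; rewrite ?mem_head].
have eDm : D = m by apply/eqP; rewrite eqn_leq Dm.
have : size ds = 1%N \/ size ds = 2%N.
  have [/hasP[z zds /eqP full]|/hasPn nfull] := boolP (has (fun z => mup z Q == m) ds).
    by left; apply: (one_full z) => //; rewrite full eDm.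
  have lt z : z \in ds -> (mup z Q < m)%N.
    by move=> zds; rewrite ltn_neqAle nfull // (leq_trans (mup_le z zds)).
  have [a ads] : exists a, a \in ds by case: (ds) ds0 => // a s _; exists a; rewrite mem_head.
  have [H0 _] : cov_H m Q != 0 /\ (mup a (cov_H m Q) + 2 = 2 * mup a Q)%N.
    by apply: mup_cov_H; rewrite // mup_gt0 // lt.
  have := sumH H0 lt; have [c TH] := propT H0.
  have sQm : size (Q : {poly C}) = m.+1 by rewrite sD eDm.
  have /= := size_cov_T m0 sQm H0 TH.
  by case=> [e e'|e e']; [right|left]; lia.
case=> sds; [left; apply/card_eq1P|right; apply/card_eq2P].
  case: (ds) sds => [|a [|]] // _; exists (Some a); apply/seteqP; split=> x /=.
    by case=> [[z]|[]]; rewrite ?inE; [move/eqP=> -> ->|].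
  by move=> ->; left; exists a; rewrite ?mem_head.
case: (ds) sds uds => [|a [|b [|]]] // _ /= /andP[ab _].
exists (Some a), (Some b); split; first by case=> e; move: ab; rewrite e mem_head.
apply/seteqP; split=> x /=.
  by case=> [[z]|[]]; rewrite ?inE //; case/orP => /eqP -> ->; [left|right].
by case=> ->; left; [exists a|exists b]; rewrite ?inE ?eqxx ?orbT.
Qed.

Lemma cov_of_few_roots m (Q : {poly_m.+1 C}) : (0 < m)%N -> Q != 0 ->
    (roots_in_sphere Q #= `I_1)%card \/ (roots_in_sphere Q #= `I_2)%card ->
  cov_H m Q = 0 \/ (exists c : C, cov_J2 m Q = tofrac c%:P).
Proof.
move=> m0 Q0 hyp; have Q0' : (Q : {poly C}) != 0 by [].
have lQ : lead_coef Q != 0 by rewrite lead_coef_eq0.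
have sQ : (size (Q : {poly C}) <= m.+1)%N by case: (Q).
have one a : (forall z, root Q z -> z = a) ->
    cov_H m Q = 0 \/ (exists c : C, cov_J2 m Q = tofrac c%:P).
  move=> h; have [|p [q [-> _]]] := @poly_two_roots C Q a a Q0'.
    by move=> z /h; left.
  by rewrite -exprD; exact: cov_J2_one_root.
have root_mem z : root Q z -> roots_in_sphere Q (Some z) by [].
case: hyp => [/card_eq1P[x Qx]|/card_eq2P[x [y [xy Qxy]]]].
  rewrite Qx in root_mem; case: x Qx root_mem => [a|] Qx root_mem.
    by apply: (one a) => z /root_mem [].
  by apply: (one 0) => z /root_mem.
rewrite Qxy in root_mem.
case: x y xy Qxy root_mem => [a|] [b|] xy Qxy root_mem //.
- have [|p [q [e1 e2]]] := @poly_two_roots C Q a b Q0'.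
    by move=> z /root_mem [] [->]; [left|right].
  rewrite e1; apply: cov_J2_two_roots => //; rewrite e2.
  have nn : ~ roots_in_sphere Q (@None C) by rewrite Qxy => -[].
  apply/eqP; rewrite eqn_leq; apply/andP; split; last first.
    by rewrite leqNgt; apply/negP => h; apply: nn; rewrite /roots_in_sphere /= subn_gt0.
  by rewrite -ltnS prednK // size_poly_gt0.
- by apply: (one a) => z /root_mem [] // [].
- by apply: (one b) => z /root_mem [] // [].
Qed.

End CovariantCriterion.

(** * The complex exponential *)

Section ExponentialSums.
Context {K : numFieldType}.
Implicit Types x y : K.

Definition expsum (n : nat) x : K := \sum_(0 <= i < n) x ^+ i / i`!%:R.

Lemma expsumD_triangle n x y :
  expsum n (x + y) =
  \sum_(i < n) \sum_(j < n | (i + j < n)%N) (x ^+ i / i`!%:R) * (y ^+ j / j`!%:R).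
Proof.
pose F i j := (x ^+ i / i`!%:R) * (y ^+ j / j`!%:R).
have powD m : (x + y) ^+ m / m`!%:R = \sum_(j < m.+1) F (m - j)%N j.
  rewrite exprDn mulr_suml; apply: eq_bigr => j _; rewrite /F.
  have jm : (j <= m)%N by rewrite -ltnS.
  rewrite -(bin_fact jm) -mulr_natr !natrM.
  have f0 i : i`!%:R != 0 :> K by rewrite pnatr_eq0 -lt0n fact_gt0.
  have c0 : 'C(m, j)%:R != 0 :> K by rewrite pnatr_eq0 -lt0n bin_gt0.
  have := f0 j; have := f0 (m - j)%N.
  move: ('C(m, j)%:R) (j`!%:R) ((m - j)`!%:R) c0 => a b c a0 c0 b0.
  by field; rewrite a0 b0 c0.
rewrite /expsum big_mkord; under eq_bigr do rewrite powD.
transitivity (\sum_(m < n) \sum_(j < n | (j < m.+1)%N) F (m - j)%N j).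
  apply: eq_bigr => m _.
  by rewrite (big_ord_widen n (fun j => F (m - j)%N j)).
rewrite [LHS](exchange_big_dep xpredT) //= [RHS](exchange_big_dep xpredT) //=.
apply: eq_bigr => j _.
rewrite -(big_mkord (fun m => j < m.+1)%N (fun m => F (m - j)%N j)).
rewrite -(big_mkord (fun i => i + j < n)%N (fun i => F i j)).
rewrite (big_cat_nat _ (n := j)) //= ?(ltnW (ltn_ord j)) //.
rewrite [X in X + _]big1_seq ?add0r; last first.
  move=> m /andP[jm]; rewrite mem_index_iota /= => mj.
  by move: jm; rewrite ltnS leqNgt mj.
rewrite [RHS](big_cat_nat _ (n := (n - j)%N)) //= ?leq_subr //.
rewrite [X in _ = _ + X]big1_seq ?addr0; last first.
  move=> m /andP[mjn]; rewrite mem_index_iota leq_subLR addnC => /andP[].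
  by rewrite leqNgt mjn.
rewrite -{1}[j : nat]add0n big_addn big_nat_cond [RHS]big_nat_cond.
apply: eq_big => [i|i _]; last by rewrite addnK.
by rewrite ltnS leq_addl andbT /= ltn_subRL addnC; case: ltnP; rewrite ?andbF.
Qed.

Lemma expsumD_defect n x y :
  expsum n x * expsum n y - expsum n (x + y) =
  \sum_(i < n) \sum_(j < n | (n <= i + j)%N) (x ^+ i / i`!%:R) * (y ^+ j / j`!%:R).
Proof.
rewrite expsumD_triangle /expsum !big_mkord mulr_suml -sumrB.
apply: eq_bigr => i _; rewrite mulr_sumr (bigID (fun j : 'I_n => i + j < n)%N) /=.
by rewrite addrAC subrr add0r; apply: eq_bigl => j; rewrite -leqNgt.
Qed.

(** The defect is a sum of monomials with nonnegative coefficients. *)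
Lemma norm_expsumD_defect n x y :
  `|expsum n x * expsum n y - expsum n (x + y)|
  <= expsum n `|x| * expsum n `|y| - expsum n (`|x| + `|y|).
Proof.
rewrite !expsumD_defect (le_trans (ler_norm_sum _ _ _)) //; apply: ler_sum => i _.
rewrite (le_trans (ler_norm_sum _ _ _)) //; apply: ler_sum => j _.
by rewrite !normrM !normfV !normrX !normr_nat.
Qed.

End ExponentialSums.

(** Limits over an abstract numeric field; the complex numbers below inherit
    their topology through this structure. *)
Section NumFieldLimits.
Context {K : numFieldType}.
Implicit Types (u v : nat -> K) (k l : K).

Lemma numField_cvgP u l :
  u @ \oo --> l <-> forall e, 0 < e -> \forall n \near \oo, `|l - u n| < e.
Proof. exact: cvgrPdist_lt. Qed.

Lemma numField_cvgD u v k l :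
  u @ \oo --> k -> v @ \oo --> l -> (fun n => u n + v n) @ \oo --> k + l.
Proof. exact: cvgD. Qed.

Lemma numField_cvgB u v k l :
  u @ \oo --> k -> v @ \oo --> l -> (fun n => u n - v n) @ \oo --> k - l.
Proof. exact: cvgB. Qed.

Lemma numField_cvgM u v k l :
  u @ \oo --> k -> v @ \oo --> l -> (fun n => u n * v n) @ \oo --> k * l.
Proof. exact: cvgM. Qed.

Lemma numField_cvg_cst k : (fun _ : nat => k) @ \oo --> k.
Proof. exact: cvg_cst. Qed.

Lemma numField_cvg_near u v l : u @ \oo --> l ->
    (forall e : K, 0 < e -> \forall n \near \oo, `|u n - v n| < e) ->
  v @ \oo --> l.
Proof.
move=> /numField_cvgP ul uv; apply/numField_cvgP => e e0.
have e2 : 0 < e / 2 by rewrite divr_gt0.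
near=> n; rewrite (splitr e) -(subrKA (u n)) (le_lt_trans (ler_normD _ _)) //.
by rewrite ltrD //; near: n; [exact: ul|exact: uv].
Unshelve. all: by end_near. Qed.

End NumFieldLimits.

Section ComplexExponential.
Local Open Scope complex_scope.
Context {R : realType}.
Local Notation C := (R[i] : numFieldType).
Implicit Types (z w : R[i]).

Definition cexp z : R[i] :=
  (expR (complex.Re z))%:C * (cos (complex.Im z) +i* sin (complex.Im z)).

Lemma cexpD z w : cexp (z + w) = cexp z * cexp w.
Proof.
case: z w => [a b] [c d]; rewrite /cexp /= expRD cosD sinD.
by apply/eqP; rewrite eq_complex /=; apply/andP; split; apply/eqP; ring.
Qed.

Lemma cexp0 : cexp 0 = 1.
Proof. by rewrite /cexp /= expR0 cos0 sin0 mul1r. Qed.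

Lemma cexpN z : cexp z * cexp (- z) = 1.
Proof. by rewrite -cexpD subrr cexp0. Qed.

Lemma real_of_pos_complex (e : R[i]) : 0 < e ->
  e = (complex.Re e)%:C /\ 0 < complex.Re e.
Proof.
rewrite ltcE /= => /andP[/eqP Ie Re0]; split=> //.
by apply/eqP; rewrite eq_complex /= -Ie !eqxx.
Qed.

Lemma lt_norm_real_complex (x e : R) : `|x| < e -> `|x%:C| < e%:C.
Proof. by move=> xe; rewrite normc_def /= expr0n addr0 sqrtr_sqr ltcR. Qed.

Lemma cvg_real_complex (u : nat -> R) (l : R) :
  u @ \oo --> l -> (fun n => (u n)%:C : C) @ \oo --> (l%:C : C).
Proof.
move=> /cvgrPdist_lt ul; apply/numField_cvgP => e /real_of_pos_complex [-> e0].
near=> n; rewrite -rmorphB; apply: lt_norm_real_complex.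
by near: n; exact: ul.
Unshelve. all: by end_near. Qed.

Lemma complexDi (x y : R) : x +i* y = x%:C + 'i * y%:C.
Proof.
by apply/eqP; rewrite eq_complex /= !(mul0r, mul1r, mulr0, subr0, addr0, add0r) !eqxx.
Qed.

Lemma cvg_complex (u v : nat -> R) (l k : R) :
  u @ \oo --> l -> v @ \oo --> k ->
  (fun n => u n +i* v n : C) @ \oo --> (l +i* k : C).
Proof.
move=> ul vk; rewrite complexDi; under eq_fun do rewrite complexDi.
apply: numField_cvgD; first exact: cvg_real_complex.
by apply: numField_cvgM; [exact: numField_cvg_cst|exact: cvg_real_complex].
Qed.

Lemma series_real_complex (f : nat -> R) n :
  (series f n)%:C = \sum_(0 <= i < n) (f i)%:C :> R[i].
Proof.
elim: n => [|n IH]; first by rewrite /series /= !big_geq.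
by rewrite seriesSr big_nat_recr //= -IH -rmorphD.
Qed.

Lemma expsum_real n (x : R) : expsum n (x%:C : C) = (series (exp_coeff x) n : R)%:C.
Proof.
rewrite [RHS](series_real_complex (exp_coeff x) n); apply: eq_bigr => i _.
by rewrite /exp_coeff /= rmorphM rmorphXn fmorphV rmorph_nat.
Qed.

Lemma expsum_imag n (x : R) :
  expsum n (0 +i* x : C) = series (cos_coeff x) n +i* series (sin_coeff x) n.
Proof.
transitivity (\sum_(0 <= i < n) (cos_coeff x i)%:C
    + 'i * \sum_(0 <= i < n) (sin_coeff x i)%:C); last first.
  rewrite [RHS]complexDi; congr (_ + 'i * _); apply/esym.
    exact: (series_real_complex (cos_coeff x) n).
  exact: (series_real_complex (sin_coeff x) n).
rewrite mulr_sumr -big_split; apply: eq_bigr => m _ /=.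
rewrite complexDi add0r exprMn /cos_coeff /sin_coeff.
have i2 : 'i ^+ 2 = -1 :> R[i] by rewrite sqr_i.
have -> : 'i ^+ m = (if odd m then 'i else 1) * (-1) ^+ m./2 :> R[i].
  rewrite -{1}(odd_double_half m) -mul2n exprD exprM i2.
  by case: (odd m).
rewrite /= -?exprnP.
have rC (e : nat) : ((-1) ^+ e * x ^+ m / m`!%:R)%:C = (-1) ^+ e * x%:C ^+ m / m`!%:R :> R[i].
  by rewrite !rmorphM !rmorphXn rmorphN1 fmorphV rmorph_nat.
case om: (odd m) => /=; rewrite !(mul0r, mul1r) ?(addr0, add0r, mulr0) rC ?mulrA //.
suff -> : (m.-1./2 = m./2)%N by [].
by clear - om; case: m om => //= m /negbTE; rewrite uphalf_half => ->.
Qed.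

(** Splitting [z] into real and imaginary parts reduces the complex series to
    the known real ones, as the failure of [S_n (x + y) = S_n x * S_n y] is
    bounded by that of the absolute values. *)
Lemma cvg_cexp z : (fun n => expsum n (z : C)) @ \oo --> (cexp z : C).
Proof.
have cvge (x : R) : (fun n => series (exp_coeff x) n : R) @ \oo --> expR x.
  exact: (is_cvg_series_exp_coeff x).
case: z => a b; rewrite /cexp /=.
apply: (@numField_cvg_near C (fun n => expsum n (a%:C : C) * expsum n (0 +i* b : C))).
  apply: numField_cvgM.
    under eq_fun do rewrite expsum_real.
    exact: (cvg_real_complex (cvge a)).
  under eq_fun do rewrite expsum_imag.
  apply: cvg_complex.
    by rewrite cos.unlock; exact: (@is_cvg_series_cos_coeff R b).
  by rewrite sin.unlock; exact: (@is_cvg_series_sin_coeff R b).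
move=> e /real_of_pos_complex [-> e0].
have -> : (a +i* b : C) = a%:C + (0 +i* b).
  by apply/eqP; rewrite eq_complex /= addr0 add0r !eqxx.
have : (fun n => (series (exp_coeff `|a|) n * series (exp_coeff `|b|) n
   - series (exp_coeff (`|a| + `|b|)) n : R)) @ \oo --> (0 : R).
  rewrite -(subrr (expR `|a| * expR `|b|)) -{2}expRD.
  by apply: cvgB => //; apply: cvgM.
move=> /cvgrPdist_lt /(_ _ e0) H; near=> n.
apply: (le_lt_trans (norm_expsumD_defect n _ _)).
have na : `|a%:C| = `|a|%:C :> R[i] by rewrite normc_def /= expr0n addr0 sqrtr_sqr.
have nb : `|0 +i* b| = `|b|%:C :> R[i] by rewrite normc_def /= expr0n add0r sqrtr_sqr.
rewrite na nb -rmorphD !expsum_real -rmorphM -rmorphB ltcR.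
apply: le_lt_trans (ler_norm _) _; rewrite -normrN -sub0r.
by near: n.
Unshelve. all: by end_near. Qed.

End ComplexExponential.

(** * Exponentials of traceless matrices of size two *)

Section TracelessExponential.
Context {K : numFieldType}.
Implicit Types (X : 'M[K]_2) (l : K).

Lemma limn_combination2 (s : nat -> 'M[K]_2) (u v : nat -> K) (a b : K) X :
    (\forall n \near \oo, s n = u n *: 1%:M + v n *: X) ->
    u @ \oo --> a -> v @ \oo --> b ->
  limn s = a%:M + b *: X.
Proof.
move=> se ua vb; apply: cvg_lim; first exact: norm_hausdorff.
rewrite -scalemx1.
have H : (fun n => u n *: (1%:M : 'M[K]_2) + v n *: X) @ \oo
    --> a *: (1%:M : 'M[K]_2) + b *: X.
  by apply: cvgD; apply: cvgZr_tmp.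
apply: cvg_trans H; apply: near_eq_cvg; near=> n; apply/esym.
by near: n.
Unshelve. all: by end_near. Qed.

Lemma expr_square_scalar X l i : l != 0 -> X * X = (l ^+ 2)%:M ->
  X ^+ i = ((l ^+ i + (- l) ^+ i) / 2) *: 1%:M
         + ((l ^+ i - (- l) ^+ i) / (2 * l)) *: X.
Proof.
move=> l0 XX; elim: i => [|i IH].
  by rewrite !expr0 subrr mul0r scale0r addr0 -(natrD _ 1 1) divff ?scale1r.
rewrite exprS IH mulrDr -!scalerAr XX mulr1 -scalemx1 scalerA addrC.
by congr (_ *: _ + _ *: _); rewrite !exprS; field.
Qed.

Lemma series_exp_square_scalar X l n : l != 0 -> X * X = (l ^+ 2)%:M ->
  series (fun i : nat => (i`!%:R)^-1 *: X ^+ i) n =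
  ((expsum n l + expsum n (- l)) / 2) *: 1%:M
  + ((expsum n l - expsum n (- l)) / (2 * l)) *: X.
Proof.
move=> l0 XX; rewrite /series /=.
under eq_bigr do rewrite (expr_square_scalar _ l0 XX) scalerDr !scalerA.
rewrite big_split -!scaler_suml /= /expsum; congr (_ *: _ + _ *: _).
  rewrite -big_split mulr_suml; apply: eq_bigr => i _ /=; by ring.
rewrite -sumrB mulr_suml; apply: eq_bigr => i _ /=; by ring.
Qed.

Lemma series_exp_square0 X n : X * X = 0 ->
  series (fun i : nat => (i`!%:R)^-1 *: X ^+ i) n.+2 = 1 *: 1%:M + 1 *: X.
Proof.
move=> XX; rewrite /series /= !big_nat_recl // big1 => [|i _].
  by rewrite expr0 expr1 invr1 !scale1r addr0.
by rewrite !exprS mulrA XX mul0r scaler0.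
Qed.

(** Cayley-Hamilton. *)
Lemma traceless_square X : \tr X = 0 -> X * X = (- \det X)%:M.
Proof.
rewrite /mxtrace !big_ord_recl big_ord0 addr0.
rewrite (_ : lift 0 0 = 1 :> 'I_2); last exact: val_inj.
move=> /eqP; rewrite addr_eq0 => /eqP X00.
by apply: mx2P; rewrite mulmx22E !mxE det2 /= ?mulr1n ?mulr0n X00; ring.
Qed.

Lemma det_scalarD_traceless (a b : K) X : \tr X = 0 ->
  \det (a%:M + b *: X) = a ^+ 2 + b ^+ 2 * \det X.
Proof.
rewrite /mxtrace !big_ord_recl big_ord0 addr0.
rewrite (_ : lift 0 0 = 1 :> 'I_2); last exact: val_inj.
move=> /eqP; rewrite addr_eq0 => /eqP X00.
by rewrite !det2 !mxE /= ?mulr1n ?mulr0n X00; ring.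
Qed.

End TracelessExponential.

Section TracelessExpmx.
Local Open Scope complex_scope.
Context {R : realType}.
Local Notation C := (R[i] : numFieldType).
Implicit Types (X : 'M[R[i]]_2) (l : R[i]).

Lemma expmx_square_scalar X l : l != 0 -> X * X = (l ^+ 2)%:M ->
  expmx X = ((cexp l + cexp (- l)) / 2)%:M + ((cexp l - cexp (- l)) / (2 * l)) *: X.
Proof.
move=> l0 XX.
apply: (@limn_combination2 C _ (fun n => (expsum n (l : C) + expsum n (- l : C)) / 2)
   (fun n => (expsum n (l : C) - expsum n (- l : C)) / (2 * l))).
- by near=> n; apply: (@series_exp_square_scalar C).
- apply: (@numField_cvgM C _ (fun=> 2^-1)); last exact: numField_cvg_cst.
  by apply: (@numField_cvgD C); exact: cvg_cexp.
- apply: (@numField_cvgM C _ (fun=> (2 * l)^-1)); last exact: numField_cvg_cst.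
  by apply: (@numField_cvgB C); exact: cvg_cexp.
Unshelve. all: by end_near. Qed.

Lemma expmx_square0 X : X * X = 0 -> expmx X = 1%:M + X.
Proof.
move=> XX; rewrite -[X in _ + X]scale1r; apply: (@limn_combination2 C _ (fun=> 1) (fun=> 1)); last 2 first.
- exact: numField_cvg_cst.
- exact: numField_cvg_cst.
near=> n; have n2 : (1 < n)%N by near: n; exact: nbhs_infty_gt.
by rewrite -(subnK n2) addn2; apply: (@series_exp_square0 C).
Unshelve. all: by end_near. Qed.

Lemma square_rootC (z : R[i]) : exists l : R[i], l ^+ 2 = z.
Proof. by exists (2.-root z)%R; rewrite rootCK. Qed.

Lemma expmx_traceless X : \tr X = 0 ->
  exists2 ab : R[i] * R[i], expmx X = ab.1%:M + ab.2 *: X & \det (expmx X) = 1.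
Proof.
move=> trX; have [l l2] := square_rootC (- \det X).
have XX := traceless_square trX; rewrite -l2 in XX.
have dX : \det X = - l ^+ 2 by rewrite l2 opprK.
have [l0|l0] := eqVneq l 0.
  rewrite l0 expr0n /= in XX dX; rewrite expmx_square0; last by rewrite XX raddf0.
  by exists (1, 1); rewrite -[X in _ + X]scale1r // det_scalarD_traceless // dX; ring.
rewrite (expmx_square_scalar l0 XX).
eexists (_, _); first by [].
rewrite det_scalarD_traceless // dX -[RHS](cexpN l) /=.
move: (cexp l) (cexp (- l)) => E F.
by field.
Qed.

Lemma norm_cexp (z : R[i]) : `|cexp z| = (expR (complex.Re z))%:C.
Proof.
case: z => a b; rewrite /cexp normrM /=.
have -> : `|(expR a)%:C| = (expR a)%:C :> R[i].
  by rewrite normc_def /= expr0n addr0 sqrtr_sqr ger0_norm // expR_ge0.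
by rewrite normc_def /= cos2Dsin2 sqrtr1 mulr1.
Qed.

(** If [X^2 = l^2] then [exp (t X)] is [cosh (t l) + (sinh (t l) / l) X], or
    [1 + t X] when [l = 0].  Both coefficients are nonzero as soon as
    [exp (4 t l)] is not 1, which holds for some real [t]. *)
Lemma expmx_generic X : \tr X = 0 -> exists t : R, exists2 ab : R[i] * R[i],
  ab.1 != 0 /\ ab.2 != 0 & expmx (t%:C *: X) = ab.1%:M + ab.2 *: X.
Proof.
move=> trX; have [l l2] := square_rootC (- \det X).
have XX := traceless_square trX; rewrite -l2 in XX.
have [l0|l0] := eqVneq l 0.
  exists 1, (1, 1); first by rewrite !oner_eq0.
  rewrite (_ : 1%:C = 1) // scale1r.
  apply: expmx_square0; have : (0 : R[i])%:M = 0 :> 'M[R[i]]_2 by exact: raddf0.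
  by move: XX; rewrite l0 expr0n => -> ->.
have [t t0 E4] : exists2 t : R, t != 0 & cexp (t%:C * l) ^+ 4 != 1.
  have e4 (z : R[i]) : cexp z ^+ 4 = cexp (z + z + (z + z)).
    by rewrite !cexpD; ring.
  case: l l0 {l2 XX} => a b l0; have [a0|a0] := eqVneq a 0.
    have b0 : b != 0 by apply: contraNneq l0 => b0; rewrite a0 b0.
    (* for imaginary [l], choose [t] with [4 t l = i pi] *)
    exists (pi / (4 * b)).
      apply: mulf_neq0; first by rewrite gt_eqF ?pi_gt0.
      by rewrite invr_eq0 mulf_neq0 // pnatr_eq0.
    rewrite e4 (_ : _ + _ = 0 +i* pi); last first.
      apply/eqP; rewrite eq_complex /= a0 !mulr0 !mul0r subr0 !addr0 eqxx /=.
      by apply/eqP; field.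
    by rewrite /cexp /= expR0 mul1r cospi sinpi eq_complex /= negb_and [-1 == 1]eq_sym -addr_eq0 -(natrD _ 1 1) pnatr_eq0.
  exists 1; first exact: oner_neq0.
  rewrite mul1r e4; apply/eqP => /(congr1 Num.norm); rewrite norm_cexp normr1 /=.
  move=> [/eqP]; rewrite -(expR0 R) => /eqP /expR_inj /= /eqP.
  by rewrite -!mulr2n -mulrnA mulrn_eq0 (negbTE a0).
have tl0 : t%:C * l != 0.
  by rewrite mulf_neq0 // eq_complex /= eqxx andbT.
have tXX : (t%:C *: X) * (t%:C *: X) = ((t%:C * l) ^+ 2)%:M.
  by rewrite -scalerAl -scalerAr XX !scale_scalar_mx; congr _%:M; ring.
set z := t%:C * l in E4 tl0 tXX.
exists t; rewrite (expmx_square_scalar tl0 tXX) scalerA.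
set E := cexp z in E4 *; set F := cexp (- z).
have EF : E * F = 1 := cexpN z.
have E22 : E ^+ 4 = (E ^+ 2) ^+ 2 by rewrite -exprM.
exists ((E + F) / 2, (E - F) / (2 * z) * t%:C) => //=; split.
  apply: mulf_neq0; last by rewrite invr_eq0 pnatr_eq0.
  apply: contraNneq E4 => e.
  have e2 : E ^+ 2 = -1 by rewrite (_ : E ^+ 2 = E * (E + F) - E * F); [rewrite e mulr0 EF sub0r|ring].
  by rewrite E22 e2 sqrrN expr1n.
have e : E - F != 0.
  apply: contraNneq E4 => e.
  have e2 : E ^+ 2 = 1 by rewrite (_ : E ^+ 2 = E * (E - F) + E * F); [rewrite e mulr0 EF add0r|ring].
  by rewrite E22 e2 expr1n.
apply: mulf_neq0; last by rewrite eq_complex /= eqxx andbT.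
by apply: mulf_neq0 => //; rewrite invr_eq0 mulf_neq0 // pnatr_eq0.
Qed.

End TracelessExpmx.

(** * Stabilizers and roots *)

Section Stabilizers.
Context {C : numClosedFieldType}.
Implicit Types (g h t : 'M[C]_2) (x y z : sphere C).

Lemma flt_poly_monomial m g (c : C) r : (r <= m)%N ->
  flt_poly m g (c *: 'X^r) = c *: ((g 0 0 *: 'X + (g 0 1)%:P) ^+ r
                                   * (g 1 0 *: 'X + (g 1 1)%:P) ^+ (m - r)).
Proof.
move=> rm; rewrite flt_polyZ /flt_poly; congr (_ *: _).
rewrite (bigD1 (Ordinal (rm : r < m.+1)%N)) //= coefXn eqxx scale1r.
rewrite big1 ?addr0 // => i; rewrite -val_eqE /= coefXn => /negbTE ->.
by rewrite scale0r.
Qed.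

Lemma stabP m (Q : {poly_m.+1 C}) s : Q != 0 ->
  stab Q s <-> exists2 h, SL2 h &
    s = mobius h /\ exists2 c : C, c != 0 & flt_poly m h Q = c *: (Q : {poly C}).
Proof.
move=> Q0; have Q0' : (Q : {poly C}) != 0 by [].
have sQ : (size (Q : {poly C}) <= m.+1)%N by case: (Q).
split=> [[h [dh hQ] <-]|[h dh [-> [c c0 hc]]]].
  exists h => //; split=> //.
  have : [set` <[Q]>%VS] (flt_act h Q) by rewrite -hQ; exists Q => //=; exact: memv_line.
  move=> /= /vlineP[c /(congr1 val) /= hc]; exists c => //.
  apply: contraNneq Q0' => c0; have hu := SL2_unit dh.
  by rewrite -(flt_polyVK hu sQ) hc c0 scale0r flt_poly0.
exists h => //; split=> //; apply/seteqP; split=> [_ [P /= /vlineP[k ->] <-]|P /= /vlineP[k ->]].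
  apply/vlineP; exists (k * c); apply/val_inj.
  by rewrite /= flt_polyZ hc scalerA.
exists ((k / c) *: Q); first by rewrite /= memvZ ?memv_line.
by apply/val_inj; rewrite /= flt_polyZ hc scalerA divfK.
Qed.

Lemma stab_roots m (Q : {poly_m.+1 C}) s x : Q != 0 -> stab Q s ->
  roots_in_sphere Q x <-> roots_in_sphere Q (s x).
Proof.
move=> Q0 /(stabP _ Q0)[h dh [-> [c c0 hc]]].
rewrite -(roots_in_sphere_flt _ (SL2_unit dh) Q0) !roots_in_sphereE //; last first.
  apply: contraNneq Q0 => /(congr1 val) /=; rewrite hc => /eqP.
  by rewrite scaler_eq0 (negbTE c0) /= => /eqP e; apply/eqP/val_inj.
rewrite /= hc form_eval_scalep; split=> [->|/eqP]; first by rewrite mulr0.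
by rewrite mulf_eq0 (negbTE c0) => /eqP.
Qed.

Lemma stab_image_roots m (Q : {poly_m.+1 C}) s : Q != 0 -> stab Q s ->
  s @` roots_in_sphere Q = roots_in_sphere Q.
Proof.
move=> Q0 Qs; have /(stabP _ Q0)[h dh [sE _]] := Qs.
apply/seteqP; split=> [_ [x Qx <-]|x Qx]; first exact: (stab_roots x Q0 Qs).1.
exists (mobius (invmx h) x); last by rewrite sE mobiusVK ?SL2_unit.
by apply: (stab_roots _ Q0 Qs).2; rewrite sE mobiusVK ?SL2_unit.
Qed.

Lemma stab_conj m (Q : {poly_m.+1 C}) g t (c : C) :
    Q != 0 -> SL2 g -> SL2 t -> c != 0 ->
    flt_poly m t (flt_poly m g Q) = c *: flt_poly m g Q ->
  stab Q (mobius (g *m t *m invmx g)).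
Proof.
move=> Q0 dg dt c0 e; apply/stabP => //; exists (g *m t *m invmx g).
  exact: SL2_mul (SL2_mul dg dt) (SL2_inv dg).
split=> //; exists c => //; rewrite -!flt_polyM e flt_polyZ flt_polyVK ?SL2_unit //.
Qed.

Lemma mobius_conj g t x : SL2 g -> SL2 t ->
  mobius (g *m t *m invmx g) (mobius g x) = mobius g (mobius t x).
Proof.
move=> dg dt; rewrite mobiusM ?unitmx_inv ?SL2_unit // mobiusK ?SL2_unit //.
by rewrite mobiusM // SL2_unit.
Qed.

(** A fractional linear transformation with three fixed points is the identity:
    moving two of them to infinity and 0 makes it a dilation. *)
Lemma mobius_fix3 k x y z : SL2 k -> x <> y -> z <> x -> z <> y ->
  mobius k x = x -> mobius k y = y -> mobius k z = z -> forall w, mobius k w = w.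
Proof.
move=> dk xy zx zy kx ky kz w.
have [g dg [gx gy]] := SL2_two_points xy; have gu := SL2_unit dg.
pose t := invmx g *m k *m g.
have tE u : mobius t u = mobius (invmx g) (mobius k (mobius g u)).
  by rewrite mobiusM // mobiusM ?SL2_unit.
have t10 : t 1 0 = 0.
  have : mobius t None = None by rewrite tE gx kx -gx mobiusK.
  by rewrite /mobius; case: eqP.
have t01 : t 0 1 = 0.
  have : mobius t (Some 0) = Some 0 by rewrite tE gy ky -gy mobiusK.
  rewrite /mobius t10 !mulr0 !add0r; case: eqP => // /eqP t11 [/eqP].
  by rewrite mulf_eq0 invr_eq0 (negbTE t11) orbF => /eqP.
have dt : t 0 0 * t 1 1 = 1.
  have : SL2 t by apply: SL2_mul => //; apply: SL2_mul => //; exact: SL2_inv.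
  by rewrite /SL2 /= det2 t10 mulr0 subr0.
have t11 : t 1 1 != 0.
  by apply: contraPneq dt => ->; rewrite mulr0 => /eqP; rewrite eq_sym oner_eq0.
have tS u : mobius t (Some u) = Some (t 0 0 * u / t 1 1).
  by rewrite /mobius t10 t01 mul0r add0r addr0 (negbTE t11).
pose z' := mobius (invmx g) z.
have tz : mobius t z' = z' by rewrite tE mobiusVK // kz.
have gz : mobius g z' = z by rewrite mobiusVK.
have tt : t 0 0 = t 1 1.
  case: z' tz gz => [u|] tz gz; last by case: zx; rewrite -gz gx.
  have u0 : u != 0 by apply/eqP => u0; case: zy; rewrite -gz u0 gy.
  move: tz; rewrite tS => -[/(canRL (divfK t11))]; rewrite mulrC => /(mulfI u0).
  by [].
have tid u : mobius t u = u.
  case: u => [u|]; first by rewrite tS tt mulrAC divff // mul1r.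
  by rewrite /mobius t10 eqxx.
have -> : mobius k w = mobius g (mobius t (mobius (invmx g) w)).
  by rewrite tE !mobiusVK.
by rewrite tid mobiusVK.
Qed.

Lemma finite_roots m (Q : {poly_m.+1 C}) : Q != 0 -> finite_set (roots_in_sphere Q).
Proof.
move=> Q0; have [ds [_ _ ->]] := roots_in_sphere_finite Q0.
apply: (@sub_finite_set _ _ ((@Some C @` [set` ds]) `|` [set None])).
  by move=> x [[z zds ->]|[-> _]]; [left; exists z|right].
rewrite finite_setU; split; last exact: finite_set1.
by apply: finite_image; exact: finite_seq.
Qed.

Lemma roots_nonempty m (Q : {poly_m.+1 C}) : (0 < m)%N -> Q != 0 ->
  exists x, roots_in_sphere Q x.
Proof.
move=> m0 Q0; have Q0' : (Q : {poly C}) != 0 by [].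
have sQ : (0 < size (Q : {poly C}))%N by rewrite size_poly_gt0.
have [sm|sm] := leqP (size (Q : {poly C})) m.
  by exists None; rewrite /roots_in_sphere /= subn_gt0 prednK.
have /closed_rootP[z Qz] : size (Q : {poly C}) != 1%N.
  by rewrite gtn_eqF // (leq_ltn_trans m0).
by exists (Some z).
Qed.

(** A fractional linear transformation is determined by its values at three
    points; with three roots, the stabilizer therefore embeds into the finite
    set of triples of roots. *)
Lemma card_roots_of_infinite_stab m (Q : {poly_m.+1 C}) : (0 < m)%N -> Q != 0 ->
    infinite_set (stab Q) ->
  (roots_in_sphere Q #= `I_1)%card \/ (roots_in_sphere Q #= `I_2)%card.
Proof.
move=> m0 Q0 inf; set F := roots_in_sphere Q; have [x Fx] := roots_nonempty m0 Q0.
have [F1|nF1] := pselect (F `<=` [set x]).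
  by left; apply/card_eq1P; exists x; apply/seteqP; split=> // y ->.
have [y [Fy yx]] : exists y, F y /\ y <> x.
  apply: contrapT => nex; apply: nF1 => y Fy /=; apply: contrapT => yx.
  by apply: nex; exists y.
have [F2|nF2] := pselect (F `<=` [set x; y]).
  right; apply/card_eq2P; exists x, y; split; first by move=> e; apply: yx.
  by apply/seteqP; split=> // z [->|->].
have [z [Fz zx zy]] : exists z, [/\ F z, z <> x & z <> y].
  apply: contrapT => nex; apply: nF2 => z Fz /=.
  have [->|zx] := pselect (z = x); first by left.
  right; apply: contrapT => zy; apply: nex; exists z; split=> //.
case: inf; pose ev (s : sphere C -> sphere C) := (s x, (s y, s z)).
have finF : finite_set F := finite_roots Q0.
have finFFF : finite_set (F `*` (F `*` F)) by do 2?apply: finite_setX.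
have injev s s' : stab Q s -> stab Q s' -> ev s = ev s' -> s = s'.
  move=> /(stabP _ Q0)[h dh [-> _]] /(stabP _ Q0)[h' dh' [-> _]] [ex ey ez].
  have kE u : mobius (invmx h' *m h) u = mobius (invmx h') (mobius h u).
    by rewrite mobiusM ?SL2_unit.
  apply/funext => w.
  rewrite -[LHS](mobiusVK (SL2_unit dh')) -kE; congr mobius.
  apply: (@mobius_fix3 _ x y z) => //.
  - exact: SL2_mul (SL2_inv dh') dh.
  - by move=> e; apply: yx.
  - by rewrite kE ex mobiusK ?SL2_unit.
  - by rewrite kE ey mobiusK ?SL2_unit.
  - by rewrite kE ez mobiusK ?SL2_unit.
have inv_ev p : exists s', forall s, stab Q s -> ev s = p -> s = s'.
  have [[s' [Qs' <-]]|no] := pselect (exists s', stab Q s' /\ ev s' = p).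
    by exists s' => s Qs; exact: injev.
  by exists id => s Qs es; case: no; exists s.
have [j jE] := choice inv_ev.
apply: (sub_finite_set _ (finite_image j finFFF)) => s Qs.
exists (ev s); last by apply/esym/jE.
by split; [|split]; exact: (stab_roots _ Q0 Qs).1.
Qed.

End Stabilizers.

(** * Stabilizers of normal forms *)

Section StabilizerNormalForms.
Context {R : realType}.
Local Notation C := R[i].
Implicit Types (g h t X : 'M[C]_2).

Lemma conj_scalarD g (a b : C) X : g \in unitmx ->
  invmx g *m (a%:M + b *: X) *m g = a%:M + b *: (invmx g *m X *m g).
Proof.
move=> gu; rewrite mulmxDr mulmxDl -!scalemxAr -!scalemxAl; congr (_ + _).
by rewrite scalar_mxC -mulmxA mulVmx // mulmx1.
Qed.

Lemma mxtrace_conj g X : g \in unitmx -> \tr (invmx g *m X *m g) = \tr X.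
Proof. by move=> gu; rewrite mxtrace_mulC mulmxA mulmxV // mul1mx. Qed.

Lemma mxtrace_conjV g X : g \in unitmx -> \tr (g *m X *m invmx g) = \tr X.
Proof. by move=> gu; rewrite mxtrace_mulC mulmxA mulVmx // mul1mx. Qed.

Lemma conjV_scalarD g (a b : C) X : g \in unitmx ->
  g *m (a%:M + b *: X) *m invmx g = a%:M + b *: (g *m X *m invmx g).
Proof.
move=> gu; rewrite mulmxDr mulmxDl -!scalemxAr -!scalemxAl; congr (_ + _).
by rewrite scalar_mxC -mulmxA mulmxV // mulmx1.
Qed.

Lemma conjK g X : g \in unitmx -> g *m (invmx g *m X *m g) *m invmx g = X.
Proof. by move=> gu; rewrite !mulmxA mulmxV // mul1mx -mulmxA mulmxV // mulmx1. Qed.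

Lemma conjVK g X : g \in unitmx -> invmx g *m (g *m X *m invmx g) *m g = X.
Proof. by move=> gu; rewrite !mulmxA mulVmx // mul1mx -mulmxA mulVmx // mulmx1. Qed.

(** The exponential of a traceless [X] is a combination [a + b X] of determinant
    1, and for some [t] both coefficients of [exp (t X)] are nonzero.  So [X] and
    its one-parameter group preserve the same lines, and the Lie algebra of the
    stabilizer is found without differentiating: it is the conjugate by [g] of
    the space [D] computed for the normal form. *)
Lemma group_dim_normal_form m (Q : {poly_m.+1 C}) g (D : {vspace 'M[C]_2}) :
    Q != 0 -> SL2 g -> (forall Y, Y \in D -> \tr Y = 0) ->
    (forall Y (a b : C), Y \in D -> SL2 (a%:M + b *: Y) ->
       exists2 c : C, c != 0 &
         flt_poly m (a%:M + b *: Y) (flt_poly m g Q) = c *: flt_poly m g Q) ->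
    (forall Y (a b : C), \tr Y = 0 -> a != 0 -> b != 0 -> SL2 (a%:M + b *: Y) ->
       (forall x, roots_in_sphere (flt_act g Q) x ->
          roots_in_sphere (flt_act g Q) (mobius (a%:M + b *: Y) x)) -> Y \in D) ->
  has_group_dim (stab Q) (\dim D).
Proof.
move=> Q0 dg trD stabD rootsD; have gu := SL2_unit dg.
pose f : 'End('M[C]_2) := linfun (mulmxr (invmx g) \o mulmx g).
have fE X : f X = g *m X *m invmx g by rewrite lfunE.
exists (f @: D)%VS; last first.
  apply: limg_dim_eq; apply/eqP; rewrite -subv0.
  apply/subvP => X; rewrite memv_cap memv_ker => /andP[_ /eqP fX].
  by rewrite memv0 -[X](conjVK _ gu) -fE fX mulmx0 mul0mx.
apply/seteqP; split=> [X /= /memv_imgP[Y YD ->]|X [trX HX] /=].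
  rewrite fE; split=> [|t].
    by rewrite mxtrace_conjV // trD.
  have trY : \tr (t%:C%C *: (g *m Y *m invmx g)) = 0.
    by rewrite mxtraceZ mxtrace_conjV // trD // mulr0.
  have [[a b] /= eX dX] := expmx_traceless trY.
  set t' := a%:M + (b * t%:C%C) *: Y.
  have eX' : expmx (t%:C%C *: (g *m Y *m invmx g)) = g *m t' *m invmx g.
    by rewrite eX scalerA /t' conjV_scalarD.
  have dt : SL2 t'.
    by move: dX; rewrite eX' /SL2 /= !det_mulmx det_inv mulrAC divff ?mul1r // dg oner_neq0.
  rewrite eX'; have [c c0 e] := stabD _ _ _ YD dt.
  exact: stab_conj e.
have [t [[a b] /= [a0 b0] eX]] := expmx_generic trX.
have dX : SL2 (a%:M + b *: X).
  have trtX : \tr (t%:C%C *: X) = 0 by rewrite mxtraceZ trX mulr0.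
  by have [_ _] := expmx_traceless trtX; rewrite eX.
apply/memv_imgP; exists (invmx g *m X *m g); last by rewrite fE conjK.
apply: (rootsD _ a b) => //; first by rewrite mxtrace_conj.
  rewrite -conj_scalarD //.
  exact: SL2_mul (SL2_mul (SL2_inv dg) dX) dg.
move=> x /(roots_in_sphere_flt _ gu Q0) Qx; apply/(roots_in_sphere_flt _ gu Q0).
rewrite -conj_scalarD // mobiusM // mobiusM ?SL2_unit // mobiusVK //.
by have := HX t; rewrite eX => /(stab_roots _ Q0) <-.
Qed.

Lemma infinite_stab_normal_form m (Q : {poly_m.+1 C}) g (t : nat -> 'M[C]_2) x :
    Q != 0 -> SL2 g -> (forall n, SL2 (t n)) ->
    (forall n, exists2 c : C, c != 0 &
       flt_poly m (t n) (flt_poly m g Q) = c *: flt_poly m g Q) ->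
    injective (fun n => mobius (t n) x) ->
  infinite_set (stab Q).
Proof.
move=> Q0 dg dt ht t_inj fin.
pose s n := mobius (g *m t n *m invmx g).
have gi : injective (mobius g) := can_inj (mobiusK (SL2_unit dg)).
have : finite_set (s @^-1` stab Q).
  apply: finite_preimage fin => n n' _ _ /(congr1 (fun f => f (mobius g x))).
  by rewrite /s !mobius_conj // => /gi /t_inj.
rewrite (_ : s @^-1` stab Q = setT); first exact: infinite_nat.
apply/seteqP; split=> // n _; have [c c0 e] := ht n.
exact: stab_conj e.
Qed.

(** A single element [t] of the stabilizer of the normal form whose fixed points
    are exactly the roots shows that no other point is fixed. *)
Lemma fixes_exactly_normal_form m k (Q : {poly_m.+1 C}) g t :
    Q != 0 -> SL2 g -> SL2 t -> (roots_in_sphere Q #= `I_k)%card ->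
    (exists2 c : C, c != 0 & flt_poly m t (flt_poly m g Q) = c *: flt_poly m g Q) ->
    (forall x, mobius t x = x <-> roots_in_sphere (flt_act g Q) x) ->
  fixes_exactly k (stab Q).
Proof.
move=> Q0 dg dt cQ [c c0 e] fixt; have gu := SL2_unit dg.
exists (roots_in_sphere Q); split=> // [s Qs|]; first exact: stab_image_roots.
apply/seteqP; split=> [x /= hx|x Qx s Qs]; last exact.
have xE : x = mobius g (mobius (invmx g) x) by rewrite mobiusVK.
rewrite xE; apply/(roots_in_sphere_flt _ gu Q0)/fixt.
apply: (can_inj (mobiusK gu)); rewrite -mobius_conj // -xE.
apply: hx; first exact: stab_conj e.
move=> y Qy; have yE : y = mobius g (mobius (invmx g) y) by rewrite mobiusVK.
rewrite yE mobius_conj //; congr mobius; apply/fixt.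
by apply/(roots_in_sphere_flt _ gu Q0); rewrite -yE.
Qed.

Lemma flt_poly_const m t (c : C) : t 1 0 = 0 ->
  flt_poly m t (c *: 'X^0) = t 1 1 ^+ m *: (c *: 'X^0).
Proof.
move=> t10; rewrite flt_poly_monomial // subn0 t10 scale0r add0r expr0 mul1r.
by rewrite -rmorphXn /= scalerA mulrC -scalerA alg_polyC.
Qed.

Lemma flt_poly_diag m t (c : C) r : (r <= m)%N -> t 1 0 = 0 -> t 0 1 = 0 ->
  flt_poly m t (c *: 'X^r) = (t 0 0 ^+ r * t 1 1 ^+ (m - r)) *: (c *: 'X^r).
Proof.
move=> rm t10 t01; rewrite flt_poly_monomial // t10 t01 scale0r add0r addr0.
rewrite exprZn -rmorphXn /= -scalerAl mulrC mul_polyC !scalerA; congr (_ *: _).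
by ring.
Qed.

Lemma SL2_triangular_diag t : SL2 t -> t 1 0 = 0 -> t 0 0 != 0 /\ t 1 1 != 0.
Proof.
rewrite /SL2 /= det2 => + t10; rewrite t10 mulr0 subr0 => d1.
by split; apply: contraPneq d1 => ->; rewrite ?mulr0 ?mul0r => /eqP; rewrite eq_sym oner_eq0.
Qed.

Definition sl2_H : 'M[C]_2 := mx2 1 0 0 (-1).
Definition sl2_E : 'M[C]_2 := mx2 0 1 0 0.

Lemma tr2 X : \tr X = X 0 0 + X 1 1.
Proof.
rewrite /mxtrace !big_ord_recl big_ord0 addr0; congr (_ + X _ _); exact: val_inj.
Qed.

Lemma diagonal_algebraP X :
  reflect [/\ \tr X = 0, X 1 0 = 0 & X 0 1 = 0] (X \in <[sl2_H]>%VS).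
Proof.
apply: (iffP (vlineP _ _)) => [[k ->]|[trX X10 X01]].
  by rewrite tr2 !mxE /= mulr1 mulrN1 subrr !mulr0.
exists (X 0 0); move: trX; rewrite tr2 => /eqP; rewrite addrC addr_eq0 => /eqP X11.
by apply: mx2P; rewrite !mxE /= ?mulr1 ?mulr0 ?mulrN1.
Qed.

Lemma triangular_algebraP X :
  reflect (\tr X = 0 /\ X 1 0 = 0) (X \in <<[:: sl2_E; sl2_H]>>%VS).
Proof.
rewrite span_cons span_seq1; apply: (iffP memv_addP) => [[u /vlineP[k ->] [v hv ->]]|].
  move/diagonal_algebraP: hv; rewrite tr2 => -[trv v10 v01].
  by rewrite tr2 !mxE /= v10 !(mulr0, add0r).
move=> [trX X10]; exists (X 0 1 *: sl2_E); first by rewrite memvZ ?memv_line.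
exists (X - X 0 1 *: sl2_E); last by rewrite addrC subrK.
apply/diagonal_algebraP; move: trX; rewrite !tr2 !mxE /= => trX.
by rewrite !mulr0 !subr0 mulr1 subrr.
Qed.

Lemma sl2_H_neq0 : sl2_H != 0.
Proof.
by apply/eqP => /matrixP /(_ 0 0) /eqP; rewrite !mxE /= oner_eq0.
Qed.

Lemma dim_triangular_algebra : \dim <<[:: sl2_E; sl2_H]>>%VS = 2%N.
Proof.
have : free [:: sl2_E; sl2_H].
  rewrite free_cons seq1_free sl2_H_neq0 andbT span_seq1.
  by apply/diagonal_algebraP => -[_ _ /eqP]; rewrite mxE /= oner_eq0.
by rewrite /free => /eqP.
Qed.

(** The root is moved to infinity; the stabilizer becomes the affine group, which
    contains the translations [T n]. *)
Lemma stab_one_root m (Q : {poly_m.+1 C}) g (c : C) : (0 < m)%N -> Q != 0 -> SL2 g ->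
    c != 0 -> flt_poly m g Q = c *: 'X^0 -> (roots_in_sphere Q #= `I_1)%card ->
  [/\ infinite_set (stab Q), has_group_dim (stab Q) 2 & fixes_exactly 1 (stab Q)].
Proof.
move=> m0 Q0 dg c0 gQ cQ.
have rootsE x : roots_in_sphere (flt_act g Q) x <-> x = None.
  rewrite (@roots_monomial C m (flt_act g Q) c 0 c0 gQ) /= m0.
  by split=> [[[]//|[]//]|->]; right.
pose T (n : nat) := mx2 1 n%:R 0 1 : 'M[C]_2.
have dT n : SL2 (T n) by rewrite /SL2 /= det_mx2 mulr1 mulr0 subr0.
have stabT t : SL2 t -> t 1 0 = 0 ->
    exists2 d : C, d != 0 & flt_poly m t (flt_poly m g Q) = d *: flt_poly m g Q.
  move=> dt t10; have [_ t11] := SL2_triangular_diag dt t10.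
  by exists (t 1 1 ^+ m); rewrite ?expf_neq0 // gQ flt_poly_const.
have T10 n : T n 1 0 = 0 by rewrite mx2E.
have mT n (z : C) : mobius (T n) (Some z) = Some (z + n%:R).
  by rewrite /mobius !mx2E mul0r add0r oner_eq0 mul1r divr1.
split.
- apply: (infinite_stab_normal_form (x := Some 0) Q0 dg dT) => [n|n n'].
    exact: stabT.
  by rewrite !mT !add0r => -[/eqP]; rewrite eqr_nat => /eqP.
- rewrite -dim_triangular_algebra; apply: (group_dim_normal_form Q0 dg).
  + by move=> Y /triangular_algebraP[].
  + move=> Y a b /triangular_algebraP[trY Y10] dY; apply: stabT => //.
    by rewrite !mxE Y10 mulr0 addr0.
  move=> Y a b trY a0 b0 dY pres; apply/triangular_algebraP; split=> //.
  have /rootsE := pres None (proj2 (rootsE None) erefl).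
  rewrite /mobius; case: eqP => // + _; rewrite !mxE /= mulr0n add0r => /eqP.
  by rewrite mulf_eq0 (negbTE b0) => /eqP.
apply: (fixes_exactly_normal_form (t := T 1) Q0 dg) => //; first exact: stabT.
move=> x; rewrite rootsE; split=> [|->]; last by rewrite /mobius T10 eqxx.
case: x => [z|//]; rewrite mT => -[/eqP].
by rewrite -subr_eq0 addrAC subrr add0r oner_eq0.
Qed.

(** The roots are moved to infinity and 0; the stabilizer contains the dilations,
    such as [T n], of ratio [4 ^ n]. *)
Lemma stab_two_roots m (Q : {poly_m.+1 C}) g (c : C) r : Q != 0 -> SL2 g ->
    c != 0 -> (0 < r < m)%N -> flt_poly m g Q = c *: 'X^r ->
    (roots_in_sphere Q #= `I_2)%card ->
  [/\ infinite_set (stab Q), has_group_dim (stab Q) 1 & fixes_exactly 2 (stab Q)].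
Proof.
move=> Q0 dg c0 /andP[r0 rm] gQ cQ.
have rootsE x : roots_in_sphere (flt_act g Q) x <-> x = None \/ x = Some 0.
  rewrite (@roots_monomial C m (flt_act g Q) c r c0 gQ) /= r0 rm.
  by split=> [[[->]|[->]]|[->|->]]; [right|left|right|left].
pose T (n : nat) := mx2 (2 ^+ n) 0 0 (2 ^+ n)^-1 : 'M[C]_2.
have n0 n : 2 ^+ n != 0 :> C by rewrite expf_neq0 // pnatr_eq0.
have dT n : SL2 (T n) by rewrite /SL2 /= det_mx2 mulr0 subr0 divff.
have stabT t : SL2 t -> t 1 0 = 0 -> t 0 1 = 0 ->
    exists2 d : C, d != 0 & flt_poly m t (flt_poly m g Q) = d *: flt_poly m g Q.
  move=> dt t10 t01; have [t00 t11] := SL2_triangular_diag dt t10.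
  exists (t 0 0 ^+ r * t 1 1 ^+ (m - r)); first by rewrite mulf_neq0 ?expf_neq0.
  by rewrite gQ flt_poly_diag // ltnW.
have T10 n : T n 1 0 = 0 by rewrite mx2E.
have T01 n : T n 0 1 = 0 by rewrite mx2E.
have mT n (z : C) : mobius (T n) (Some z) = Some (4 ^+ n * z).
  rewrite /mobius !mx2E mul0r add0r invr_eq0 (negbTE (n0 n)) addr0 invrK mulrAC.
  by rewrite -exprMn -natrM.
split.
- apply: (infinite_stab_normal_form (x := Some 1) Q0 dg dT) => [n|n n'].
    exact: stabT.
  rewrite !mT !mulr1 => -[/eqP]; rewrite -!natrX eqr_nat => /eqP.
  by apply: expnI.
- have -> : 1%N = \dim <[sl2_H]>%VS by rewrite dim_vline sl2_H_neq0.
  apply: (group_dim_normal_form Q0 dg).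
  + by move=> Y /diagonal_algebraP[].
  + move=> Y a b /diagonal_algebraP[trY Y10 Y01] dY; apply: stabT => //.
      by rewrite !mxE Y10 mulr0 addr0.
    by rewrite !mxE Y01 mulr0 addr0.
  move=> Y a b trY a0 b0 dY pres; set t := _ + _ in dY pres.
  have t10 : t 1 0 = b * Y 1 0 by rewrite !mxE /= mulr0n add0r.
  have t01 : t 0 1 = b * Y 0 1 by rewrite !mxE /= mulr0n add0r.
  have t00 : t 0 0 = a + b * Y 0 0 by rewrite !mxE /= mulr1n.
  have t11 : t 1 1 = a + b * Y 1 1 by rewrite !mxE /= mulr1n.
  have tI : injective (mobius t) := can_inj (mobiusK (SL2_unit dY)).
  have hN := proj1 (rootsE _) (pres None (proj2 (rootsE None) (or_introl erefl))).
  have h0 := proj1 (rootsE _) (pres (Some 0) (proj2 (rootsE (Some 0)) (or_intror erefl))).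
  case: hN => hN.
    have {}t10 : Y 1 0 = 0.
      move: hN; rewrite /mobius; case: eqP => // + _; rewrite t10 => /eqP.
      by rewrite mulf_eq0 (negbTE b0) => /eqP.
    apply/diagonal_algebraP; split=> //.
    case: h0 => h0; first by have := tI _ _ (etrans hN (esym h0)).
    move: h0; rewrite /mobius !mulr0 !add0r; case: eqP => // /eqP nz [/eqP].
    by rewrite mulf_eq0 invr_eq0 (negbTE nz) orbF t01 mulf_eq0 (negbTE b0) => /eqP.
  case: h0 => h0; last by have := tI _ _ (etrans hN (esym h0)).
  (* an interchange of the two roots would make [a + b Y] traceless *)
  have z00 : t 0 0 = 0.
    move: hN; rewrite /mobius; case: eqP => // /eqP nz [/eqP].
    by rewrite mulf_eq0 invr_eq0 (negbTE nz) orbF => /eqP.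
  have z11 : t 1 1 = 0.
    by move: h0; rewrite /mobius !mulr0 !add0r; case: eqP.
  have : a + a + b * \tr Y = 0.
    by rewrite tr2 mulrDr addrACA -t00 -t11 z00 z11 addr0.
  rewrite trY mulr0 addr0 -mulr2n => /eqP; rewrite mulrn_eq0 /=.
  by rewrite (negbTE a0).
apply: (fixes_exactly_normal_form (t := T 1) Q0 dg) => //; first exact: stabT.
move=> x; rewrite rootsE; case: x => [z|]; last first.
  by rewrite /mobius T10 eqxx; split=> // _; left.
rewrite mT expr1; split=> [[/eqP]|[//|[->]]]; last by rewrite mulr0.
rewrite -subr_eq0 -{2}[z]mul1r -mulrBl mulf_eq0 subr_eq0 (eqr_nat _ 4 1) /=.
by move=> /eqP ->; right.
Qed.

Lemma stab_of_few_roots m (Q : {poly_m.+1 C}) : (0 < m)%N -> Q != 0 ->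
    (roots_in_sphere Q #= `I_1)%card \/ (roots_in_sphere Q #= `I_2)%card ->
  infinite_set (stab Q) /\
    ((has_group_dim (stab Q) 2 /\ fixes_exactly 1 (stab Q)) \/
     (has_group_dim (stab Q) 1 /\ fixes_exactly 2 (stab Q))).
Proof.
move=> m0 Q0 [cQ|cQ]; [have /card_eq1P[x Qx] := cQ|have /card_eq2P[x [y [xy Qxy]]] := cQ].
  have [y xy] := sphere_other x; have [g dg [gx _]] := SL2_two_points xy.
  have [|c c0 gQ] := one_root_normal_form Q0 dg; first by rewrite gx.
  by have [? ? ?] := stab_one_root m0 Q0 dg c0 gQ cQ; split=> //; left.
have [g dg [gx gy]] := SL2_two_points xy.
have [|c c0 [r rm gQ]] := two_roots_normal_form Q0 dg; first by rewrite gx gy.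
by have [? ? ?] := stab_two_roots Q0 dg c0 rm gQ cQ; split=> //; right.
Qed.

End StabilizerNormalForms.

(** * The equivalence *)

Theorem theorem5p7 (R : realType) (n k : nat)
    (hk : (1 <= k <= n.+1)%N) (hN : (0 < k * (n.+1 - k))%N)
    (U : {vspace {poly_n.+1 R[i]}}) (hU : \dim U = k)
    (Q : {poly_(k * (n.+1 - k)).+1 R[i]})
    (hQ : wronskian_line U Q) (hQ0 : Q != 0) :
  let N := (k * (n.+1 - k))%N in
  [<->
       exists2 M : {vspace {poly_n.+1 R[i]}},
         monomial_subspace k M & proj_equiv U M;
       (roots_in_sphere Q #= `I_1)%card \/ (roots_in_sphere Q #= `I_2)%card;
       cov_H N Q = 0 \/ (exists c : R[i], cov_J2 N Q = tofrac c%:P);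
       infinite_set (stab Q) /\
       ((has_group_dim (stab Q) 2 /\ fixes_exactly 1 (stab Q)) \/
        (has_group_dim (stab Q) 1 /\ fixes_exactly 2 (stab Q)))].
Proof.
move=> N; have [_ kn] := andP hk.
have [monoP rootsP] := (proj_equiv_monomial_subspaceP kn hQ hQ0,
  card_rootsP hN hQ0).
tfae.
- by move/monoP/rootsP.
- exact: cov_of_few_roots.
- by move=> hcov; apply: stab_of_few_roots => //; exact: few_roots_of_cov.
- by case=> inf _; apply/monoP/rootsP; exact: card_roots_of_infinite_stab.
Qed.
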